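(* If $X$ is a compact length space with a simply connected universal cover, then $$2\,\mathrm{CovSpec}(X)\subset L_{1/2}(X),$$ where $2\,\mathrm{CovSpec}(X)=\{2\delta:\delta\in\mathrm{CovSpec}(X)\}$.
   Context: A compact length space is a compact metric space in which every pair of points is joined by a rectifiable curve whose length equals the distance between the points. $S^1=\mathbb{R}/2\pi\mathbb{Z}$. A closed geodesic in $X$ is a nonconstant map $\gamma:S^1\to X$ that is locally length minimizing around every point of $S^1$, parametrized proportionally to arclength with speed $L(\gamma)/(2\pi)$, where $L(\gamma)$ is its length. A $1/2$ geodesic is a closed geodesic $\gamma$ with $d(\gamma(t),\gamma(t+\pi))=L(\gamma)/2$ for all $t\in S^1$. $L_{1/2}(X)$ is the set of lengths of $1/2$ geodesics in $X$. Covering spectrum (Sormani–Wei): for $\delta>0$ and $p\in X$, let $\pi_1(X,\delta,p)\subset\pi_1(X,p)$ be the normal subgroup generated by homotopy classes of loops of the form $\alpha\cdot\beta\cdot\alpha^{-1}$, where $\beta$ is a closed path lying in some open ball of radius $\delta$ in $X$ and $\alpha$ is a path from $p$ to $\beta(0)$. The $\delta$-cover $\tilde{X}^\delta$ is the covering space of $X$ corresponding to the subgroup $\pi_1(X,\delta,p)$. Then $\mathrm{CovSpec}(X)$ is the set of all $\delta>0$ such that $\tilde{X}^\delta\ne\tilde{X}^{\delta'}$ (as covering spaces of $X$) for all $\delta'>\delta$. *)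

(* Defs.v *)
From HB Require Import structures.
From mathcomp Require Import all_boot all_order all_algebra.
From mathcomp Require Import all_classical all_reals all_analysis.

Set Implicit Arguments.
Unset Strict Implicit.
Unset Printing Implicit Defensive.

Import Order.TTheory GRing.Theory Num.Theory.
Import numFieldNormedType.Exports.

Local Open Scope classical_set_scope.
Local Open Scope ring_scope.

(* A path is a function on [R] of which only the restriction to [0, 1]
   matters. *)
Section paths.
Context {R : realType} {T : topologicalType}.
Implicit Types (f g : R -> T) (x y : T).

Definition is_path x y f :=
  [/\ {within `[0, 1], continuous f}, f 0 = x & f 1 = y].

Definition is_loop x f := is_path x x f.

Definition path_cat f g : R -> T :=
  fun t => if t <= 2^-1 then f (2 * t) else g (2 * t - 1).

Definition path_rev f : R -> T := fun t => f (1 - t).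

(* Homotopy relative to the endpoints; it forces [f] and [g] to be paths with
   the same endpoints. *)
Definition path_homotopic f g := exists H : R * R -> T,
  [/\ {within `[0, 1] `*` `[0, 1], continuous H},
      (forall t, 0 <= t <= 1 -> H (t, 0) = f t),
      (forall t, 0 <= t <= 1 -> H (t, 1) = g t) &
      forall s, 0 <= s <= 1 -> H (0, s) = f 0 /\ H (1, s) = f 1].

(* A subset of the fundamental group at [p] is represented by the
   homotopy-invariant set of all loops whose class it contains. *)
Record pi1_normal_subgroup (p : T) (H : set (R -> T)) : Prop := {
  pi1_loop : forall f, H f -> is_loop p f ;
  pi1_homotopic : forall f g, H f -> path_homotopic f g -> H g ;
  pi1_one : H (cst p) ;
  pi1_mul : forall f g, H f -> H g -> H (path_cat f g) ;
  pi1_inv : forall f, H f -> H (path_rev f) ;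
  pi1_conj : forall f g, H f -> is_loop p g ->
    H (path_cat (path_cat g f) (path_rev g))
}.

End paths.

Definition path_connected (R : realType) (T : topologicalType) :=
  forall x y : T, exists f : R -> T, is_path x y f.

Definition simply_connected (R : realType) (T : topologicalType) :=
  path_connected R T /\
  forall (x : T) (f : R -> T), is_loop x f -> path_homotopic f (cst x).

Record space_over (X : topologicalType) := SpaceOver {
  total_space : topologicalType ;
  projection : total_space -> X
}.

Section coverings.
Context {R : realType} {X : topologicalType}.
Implicit Types C D : space_over X.

Definition homeo_on (T U : topologicalType) (A : set T) (B : set U)
    (f : T -> U) := exists g : U -> T,
  [/\ {within A, continuous f} /\ {within B, continuous g},
      (forall x, A x -> B (f x)) /\ (forall y, B y -> A (g y)),
      forall x, A x -> g (f x) = x &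
      forall y, B y -> f (g y) = y].

Definition evenly_covered (E : topologicalType) (q : E -> X) (U : set X) :=
  exists (I : Type) (V : I -> set E),
  [/\ forall i, open (V i),
      forall i j, V i `&` V j !=set0 -> i = j,
      q @^-1` U = \bigcup_i V i &
      forall i, homeo_on (V i) U q].

(* Covering spaces are taken to be path-connected, as in the correspondence
   with subgroups of the fundamental group. *)
Definition covering_space C :=
  [/\ path_connected R (total_space C),
      continuous (@projection _ C),
      forall x, exists e : total_space C, projection e = x &
      forall x, exists U : set X,
        [/\ open U, U x & evenly_covered (@projection _ C) U]].

Definition over_map C D (phi : total_space C -> total_space D) :=
  continuous phi /\ forall e, projection (phi e) = projection e.

Definition over_iso C D := exists phi psi,
  [/\ @over_map C D phi, @over_map D C psi, cancel phi psi & cancel psi phi].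

Definition universal_cover C :=
  covering_space C /\
  forall D, covering_space D -> exists phi, @over_map C D phi.

(* The image in pi_1(X, projection e) of pi_1(total_space C, e). *)
Definition pi1_image C (e : total_space C) : set (R -> X) :=
  [set f | exists2 g : R -> total_space C,
             is_loop e g & path_homotopic (@projection _ C \o g) f].

Definition covering_corresponds (p : X) (H : set (R -> X)) C :=
  covering_space C /\
  exists e : total_space C, projection e = p /\ pi1_image e = H.

(* "The" covering space corresponding to [H], unique up to isomorphism over
   [X], is picked by choice. The default value [X] is junk: the covering space
   exists for the subgroups [pi1_delta] below when [X] is a length space, whose
   balls are path-connected. *)
Definition covering_of (p : X) (H : set (R -> X)) : space_over X :=
  if pselect (exists C, covering_corresponds p H C) is left ex
  then projT1 (cid ex) else @SpaceOver X X id.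

End coverings.

Section metric_notions.
Context {R : realType} {X : metricType R}.
Implicit Types (g : R -> X).

Definition curve_length g (a b : R) : \bar R :=
  ereal_sup [set (\sum_(0 <= n < size s)
      mdist (g (nth b (a :: s) n)) (g (nth b (a :: s) n.+1)))%:E
    | s in itv_partition a b].

Definition length_minimizing g (a b : R) := forall c : R -> X,
  is_path (g a) (g b) c -> (curve_length g a b <= curve_length c 0 1)%E.

(* Maps from the circle R/2piZ are the 2pi-periodic maps on [R]. *)
Definition circle_map g := continuous g /\ forall t, g (t + 2 * pi) = g t.

Definition circle_length g : \bar R := curve_length g 0 (2 * pi).

Definition closed_geodesic g :=
  [/\ circle_map g,
      exists s t, g s <> g t,
      forall t, exists2 e : R, 0 < e &
        forall a b, t - e <= a -> a <= b -> b <= t + e ->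
          length_minimizing g a b,
      circle_length g \is a fin_num &
      forall a b, a <= b ->
        curve_length g a b =
          (fine (circle_length g) / (2 * pi) * (b - a))%:E].

Definition half_geodesic g :=
  closed_geodesic g /\
  forall t, mdist (g t) (g (t + pi)) = fine (circle_length g) / 2.

Definition delta_loops (delta : R) (p : X) : set (R -> X) :=
  [set f | exists (alpha beta : R -> X) (x : X),
    [/\ is_path p (beta 0) alpha,
        is_loop (beta 0) beta,
        forall t, 0 <= t <= 1 -> ball x delta (beta t) &
        f = path_cat (path_cat alpha beta) (path_rev alpha)]].

Definition pi1_delta (delta : R) (p : X) : set (R -> X) :=
  smallest (pi1_normal_subgroup p) (delta_loops delta p).

Definition delta_cover (delta : R) (p : X) : space_over X :=
  covering_of p (pi1_delta delta p).

Definition CovSpec (p : X) : set R :=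
  [set delta | 0 < delta /\ forall delta', delta < delta' ->
    ~ over_iso (delta_cover delta p) (delta_cover delta' p)].

End metric_notions.

Definition L_half (R : realType) (X : metricType R) : set R :=
  [set l | exists g : R -> X, half_geodesic g /\ circle_length g = l%:E].

Definition length_space (R : realType) (X : metricType R) :=
  forall x y : X, exists c : R -> X,
    is_path x y c /\ curve_length c 0 1 = (mdist x y)%:E.

(* Main.v *)
Require Import Defs.
From HB Require Import structures.
From mathcomp Require Import all_boot all_order all_algebra.
From mathcomp Require Import generic_quotient.
From mathcomp Require Import all_classical all_reals all_analysis.
From mathcomp Require Import lra ring.
Set Implicit Arguments.
Unset Strict Implicit.
Unset Printing Implicit Defensive.
Import Order.TTheory GRing.Theory Num.Theory.
Import numFieldNormedType.Exports.
Local Open Scope classical_set_scope.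
Local Open Scope ring_scope.

(** Call a loop trivial if its conjugates to [p] lie in [pi1_delta delta p], and
    let [delta] be in the covering spectrum. Since [covering_of] depends on the
    subgroup only, [pi1_delta delta' p] differs from [pi1_delta delta p] for
    every [delta' > delta], so some ball of radius [delta'] contains a
    nontrivial loop ([CovSpec_new_loop]). The proof shows that a shortest
    nontrivial loop exists, has length [2 * delta], and is a half geodesic.

    - Every loop of length less than [2 * delta] lies in the ball of radius
      [delta] around any of its points, hence is trivial ([short_tr]).

    - A loop in a ball of radius [delta'] is, up to small loops, a product of
      conjugates of geodesic triangles with one vertex at the centre and a tiny
      opposite side ([loop_fills_by_triangles]). One of these triangles is
      nontrivial, and its length is barely more than [2 * delta']
      ([short_nontrivial_loop]).

    - As [delta'] tends to [delta], compactness of [X] yields a limit of these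
      triangles, a loop of length at most [2 * delta]. Uniformly close loops
      are trivial together, because the thin squares between them fit in balls
      of radius [delta] ([tr_ladder]), so the limit is nontrivial
      ([minimal_nontrivial_loop]).

    - If two antipodal points of the limit were at distance less than [delta],
      the chord between them would cut it into two loops shorter than
      [2 * delta], and it would be trivial ([antipodal_mdist]). So antipodal
      points are at distance [delta], and the triangle inequality makes every
      arc of at most half the loop minimizing ([half_period_isometry]).

    Triviality is handled through a group-valued [transport] along curves. Its
    value on a curve is the class, in the quotient of the fundamental group by
    [pi1_delta delta p], of the curve closed up by fixed paths from [p] to its
    endpoints. Transport is multiplicative under concatenation and trivial on
    loops in balls of radius [delta], and a loop with trivial transport is
    trivial ([pi1_delta_transport]); the metric arguments need nothing else from
    homotopy theory. *)

(** * Continuity of maps defined by cases *)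

Lemma within_comp (S T U : topologicalType) (B : set S) (A : set T)
    (g : S -> T) (f : T -> U) :
  {within B, continuous g} -> {within A, continuous f} ->
  (forall x, B x -> A (g x)) -> {within B, continuous (f \o g)}.
Proof.
move=> /subspace_continuousP cg /subspace_continuousP cf gBA.
apply/subspace_continuousP => x Bx.
apply: (@cvg_comp _ _ _ g f _ (within A (nbhs (g x)))); last exact: cf (gBA _ Bx).
move=> V AV; have := cg x Bx _ AV.
rewrite /nbhs /= /within /=; apply: filterS => y h By.
exact: h By (gBA _ By).
Qed.

Lemma paste_continuous (R : realType) (S T : topologicalType) (A : set S)
    (u : S -> R) (c : R) (f g : S -> T) :
  continuous u -> closed A ->
  {within A `&` [set x | u x <= c], continuous f} ->
  {within A `&` [set x | c <= u x], continuous g} ->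
  (forall x, A x -> u x = c -> f x = g x) ->
  {within A, continuous (fun x => if u x <= c then f x else g x)}.
Proof.
move=> cu cA cf cg fg.
have cle : closed [set x | u x <= c].
  by apply: (@preimage_closed _ _ u [set y | y <= c]) => [x _|]; [exact: cu|exact: closed_le].
have cge : closed [set x | c <= u x].
  by apply: (@preimage_closed _ _ u [set y | c <= y]) => [x _|]; [exact: cu|exact: closed_ge].
have -> : A = (A `&` [set x | u x <= c]) `|` (A `&` [set x | c <= u x]).
  rewrite -setIUr; apply/seteqP; split => [x Ax|x []//]; split=> //=.
  by case: (leP (u x) c) => h; [left|right; exact: ltW].
apply: withinU_continuous; [exact: closedI|exact: closedI| |].
- apply: subspace_eq_continuous cf => x.
  by rewrite inE /from_subspace => -[Ax /= ->].
- apply: subspace_eq_continuous cg => x.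
  rewrite inE /from_subspace => -[Ax /= cux]; case: ifP => // uxc.
  by rewrite fg//; apply/eqP; rewrite eq_le uxc cux.
Qed.

(** * Homotopy of paths *)

Section homotopy.
Context {R : realType} {T : topologicalType}.
Implicit Types (f g h : R -> T) (x y z : T).

Let I : set R := `[0, 1].
Let II : set (R * R) := `[0, 1] `*` `[0, 1].

Lemma interval_comp (S : topologicalType) (B : set S) (a : S -> R) f :
  continuous a -> {within I, continuous f} ->
  (forall s, B s -> 0 <= a s <= 1) -> {within B, continuous (fun s => f (a s))}.
Proof.
move=> ca cf aI; apply: (within_comp (f := f) _ cf); first exact: continuous_subspaceT.
by move=> s Bs; rewrite /I /= in_itv /= aI.
Qed.

Lemma square_comp (S : topologicalType) (B : set S) (a b : S -> R)
    (H : R * R -> T) :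
  continuous a -> continuous b -> {within II, continuous H} ->
  (forall s, B s -> 0 <= a s <= 1 /\ 0 <= b s <= 1) ->
  {within B, continuous (fun s => H (a s, b s))}.
Proof.
move=> ca cb cH abI.
apply: (within_comp (g := fun s => (a s, b s)) (f := H) _ cH) => [|s Bs].
  by apply: continuous_subspaceT => s; exact: (cvg_pair (ca s) (cb s)).
by have [? ?] := abI s Bs; split; rewrite /= in_itv.
Qed.

Lemma affine_continuous (S : topologicalType) (u : S -> R) (a b : R) :
  continuous u -> continuous (fun t => a * u t + b).
Proof.
move=> cu t; apply: cvgD; last exact: cvg_cst.
by apply: cvgM; [exact: cvg_cst|exact: cu].
Qed.

(* Kept as assumptions, so that [//] closes the continuity side conditions. *)
Let cfst : continuous (@fst R R). Proof. by move=> ts; exact: cvg_fst. Qed.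
Let csnd : continuous (@snd R R). Proof. by move=> ts; exact: cvg_snd. Qed.
Let cidR : continuous (@id R). Proof. by move=> ts; exact: cvg_id. Qed.

Lemma is_pathP x y f g :
  is_path x y f -> (forall t, 0 <= t <= 1 -> f t = g t) -> is_path x y g.
Proof.
move=> [cf f0 f1] fg; split; last 2 first.
- by rewrite -fg ?lexx ?ler01.
- by rewrite -fg ?lexx ?ler01.
apply: subspace_eq_continuous cf => t.
by rewrite inE /from_subspace /= in_itv /= => ?; rewrite fg.
Qed.

Lemma is_path_cst x : is_path x x (@cst R T x).
Proof. by split=> //; apply: continuous_subspaceT => ?; exact: cvg_cst. Qed.

Lemma is_path_rev x y f : is_path x y f -> is_path y x (path_rev f).
Proof.
move=> [cf f0 f1]; rewrite /path_rev; split; rewrite ?subr0 ?subrr //.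
apply: interval_comp => // [t|t /=].
  by apply: cvgB; [exact: cvg_cst|exact: cvg_id].
by rewrite in_itv /=; lra.
Qed.

Lemma is_path_cat x y z f g :
  is_path x y f -> is_path y z g -> is_path x z (path_cat f g).
Proof.
move=> [cf f0 f1] [cg g0 g1]; split; last 2 first.
- by rewrite /path_cat invr_ge0 ler0n mulr0.
- rewrite /path_cat; have -> : (1 <= 2^-1 :> R) = false by lra.
  by rewrite mulr1 -g1; congr g; ring.
apply: (@paste_continuous _ _ _ _ id) => //.
- exact: itv_closed.
- apply: interval_comp => // [|t [] /=].
    by move=> t; apply: cvgM; [exact: cvg_cst|exact: cvg_id].
  by rewrite !in_itv /= => /andP[? ?] ?; lra.
- apply: interval_comp => // [|t [] /=]; first exact: affine_continuous.
  by rewrite !in_itv /= => /andP[? ?] ?; lra.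
- move=> t _ ->; have -> : 2 * 2^-1 = 1 :> R by field.
  by rewrite subrr f1 g0.
Qed.

Lemma htp_ends f g : path_homotopic f g -> f 0 = g 0 /\ f 1 = g 1.
Proof.
move=> [H [cH Hf Hg He]].
have [H01 H11] : H (0, 1) = f 0 /\ H (1, 1) = f 1 by apply: He; rewrite lexx ler01.
by rewrite -H01 -H11 !Hg ?lexx ?ler01.
Qed.

Lemma htp_eq x y f g : is_path x y f -> (forall t, 0 <= t <= 1 -> f t = g t) ->
  path_homotopic f g.
Proof.
move=> [cf _ _] fg; exists (fun ts => f ts.1); split=> //.
by apply: interval_comp => // -[t s] [] /=; rewrite in_itv.
Qed.

Lemma htp_refl x y f : is_path x y f -> path_homotopic f f.
Proof. by move=> /htp_eq; exact. Qed.

Lemma htp_sym f g : path_homotopic f g -> path_homotopic g f.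
Proof.
move=> fg; have [g0 g1] := htp_ends fg; case: fg => H [cH Hf Hg He].
exists (fun ts => H (ts.1, 1 - ts.2)); split.
- apply: square_comp => // [ts|[t s] []].
    by apply: cvgB; [exact: cvg_cst|exact: cvg_snd].
  by rewrite /= !in_itv /= => t01 /andP[s0 s1]; split=> //; lra.
- by move=> t t01 /=; rewrite subr0 Hg.
- by move=> t t01 /=; rewrite subrr Hf.
- by move=> s /andP[s0 s1] /=; rewrite -g0 -g1; apply: He; lra.
Qed.

Lemma htp_path x y f g :
  is_path x y f -> path_homotopic f g -> is_path x y g.
Proof.
move=> [_ f0 f1] fg; have [g0 g1] := htp_ends fg; case: fg => H [cH Hf Hg He].
apply: (@is_pathP _ _ (fun t => H (t, 1))) => [|t t01]; last exact: Hg.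
split; rewrite ?Hg -?g0 -?g1 ?lexx ?ler01 //.
apply: square_comp => // [t|t /=]; first exact: cvg_cst.
by rewrite in_itv /= lexx ler01.
Qed.

Lemma closed_square : closed II.
Proof.
have -> : II = fst @^-1` `[0, 1] `&` snd @^-1` `[0, 1] by apply/seteqP; split=> -[].
apply: closedI; apply: preimage_closed => [ts _|].
- exact: cvg_fst.
- exact: itv_closed.
- exact: cvg_snd.
- exact: itv_closed.
Qed.

Lemma htp_trans f g h :
  path_homotopic f g -> path_homotopic g h -> path_homotopic f h.
Proof.
move=> fg; have [g0 g1] := htp_ends fg; case: fg => H [cH Hf Hg He].
move=> [K [cK Kg Kh Ke]].
exists (fun ts => if ts.2 <= 2^-1 then H (ts.1, 2 * ts.2 + 0)
                  else K (ts.1, 2 * ts.2 + - 1)).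
split.
- apply: (@paste_continuous _ _ _ _ snd) => //.
  + exact: closed_square.
  + apply: square_comp => // [|[t s] [[]] /=]; first exact: affine_continuous.
    by rewrite !in_itv /= => t01 /andP[s0 s1] s2; split=> //; lra.
  + apply: square_comp => // [|[t s] [[]] /=]; first exact: affine_continuous.
    by rewrite !in_itv /= => t01 /andP[s0 s1] s2; split=> //; lra.
  + move=> [t s] [] /=; rewrite !in_itv /= => t01 _ ->.
    have -> : 2 * 2^-1 = 1 :> R by field.
    by rewrite subrr addr0 Hg ?Kg.
- by move=> t t01 /=; rewrite invr_ge0 ler0n mulr0 addr0 Hf.
- move=> t t01 /=; have -> : (1 <= 2^-1 :> R) = false by lra.
  have -> : 2 * 1 + - 1 = 1 :> R by ring.
  by rewrite Kh.
- move=> s /andP[s0 s1] /=; case: ifPn => s2; first by apply: He; lra.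
  by rewrite g0 g1; apply: Ke; lra.
Qed.

Lemma htp_cat f f' g g' : f 1 = g 0 ->
  path_homotopic f f' -> path_homotopic g g' ->
  path_homotopic (path_cat f g) (path_cat f' g').
Proof.
move=> fg [H [cH Hf Hf' He]] [K [cK Kg Kg' Ke]].
exists (fun ts => if ts.1 <= 2^-1 then H (2 * ts.1 + 0, ts.2)
                  else K (2 * ts.1 + - 1, ts.2)).
split.
- apply: (@paste_continuous _ _ _ _ fst) => //.
  + exact: closed_square.
  + apply: square_comp => // [|[t s] [[]] /=]; first exact: affine_continuous.
    by rewrite !in_itv /= => /andP[t0 t1] s01 t2; split=> //; lra.
  + apply: square_comp => // [|[t s] [[]] /=]; first exact: affine_continuous.
    by rewrite !in_itv /= => /andP[t0 t1] s01 t2; split=> //; lra.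
  + move=> [t s] [] /=; rewrite !in_itv /= => _ s01 ->.
    have -> : 2 * 2^-1 = 1 :> R by field.
    rewrite subrr addr0.
    by have [_ ->] := He s s01; have [-> _] := Ke s s01.
- move=> t /andP[t0 t1]; rewrite /path_cat /= ?addr0; case: ifPn => t2.
    by apply: Hf; lra.
  by apply: Kg; lra.
- move=> t /andP[t0 t1]; rewrite /path_cat /= ?addr0; case: ifPn => t2.
    by apply: Hf'; lra.
  by apply: Kg'; lra.
- move=> s s01 /=; rewrite /path_cat invr_ge0 ler0n !mulr0 addr0.
  have -> : (1 <= 2^-1 :> R) = false by lra.
  have -> : 2 * 1 - 1 = 1 :> R by ring.
  by have [-> _] := He s s01; have [_ ->] := Ke s s01.
Qed.

Lemma htp_rev f g : path_homotopic f g ->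
  path_homotopic (path_rev f) (path_rev g).
Proof.
move=> [H [cH Hf Hg He]]; exists (fun ts => H (1 - ts.1, ts.2)); split.
- apply: square_comp => // [ts|[t s] []].
    by apply: cvgB; [exact: cvg_cst|exact: cvg_fst].
  by rewrite /= !in_itv /= => /andP[t0 t1] s01; split=> //; lra.
- by move=> t /andP[t0 t1] /=; apply: Hf; lra.
- by move=> t /andP[t0 t1] /=; apply: Hg; lra.
- by move=> s s01 /=; rewrite /path_rev subr0 subrr; have [-> ->] := He s s01.
Qed.

(** The straight line homotopy between the parameters works. Associativity,
    units and inverses all follow, since each compares two piecewise affine
    reparametrizations of a single path. *)
Lemma htp_reparam (A : set R) f (u v : R -> R) :
  {within A, continuous f} -> continuous u -> continuous v ->
  (forall s t c, A s -> A t -> 0 <= c <= 1 -> A ((1 - c) * s + c * t)) ->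
  (forall t, 0 <= t <= 1 -> A (u t) /\ A (v t)) ->
  u 0 = v 0 -> u 1 = v 1 ->
  path_homotopic (f \o u) (f \o v).
Proof.
move=> cf cu cv Acvx uvA uv0 uv1.
pose w (ts : R * R) := (1 - ts.2) * u ts.1 + ts.2 * v ts.1.
exists (fun ts => f (w ts)); rewrite /w; split.
- apply: (within_comp (g := w) (f := f) _ cf) => [|[t s] []].
    apply: continuous_subspaceT => ts; apply: cvgD; apply: cvgM.
    + by apply: cvgB; [exact: cvg_cst|exact: cvg_snd].
    + by apply: (cvg_comp _ _ cvg_fst); exact: cu.
    + exact: cvg_snd.
    + by apply: (cvg_comp _ _ cvg_fst); exact: cv.
  rewrite /= !in_itv /= => t01 s01.
  by have [? ?] := uvA _ t01; exact: Acvx.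
- by move=> t _ /=; rewrite subr0 mul1r mul0r addr0.
- by move=> t _ /=; rewrite subrr mul1r mul0r add0r.
- by move=> s _ /=; rewrite -uv0 -uv1; split; congr f; ring.
Qed.

Lemma htp_reparam01 x y f (u v : R -> R) :
  is_path x y f -> continuous u -> continuous v ->
  (forall t, 0 <= t <= 1 -> 0 <= u t <= 1 /\ 0 <= v t <= 1) ->
  u 0 = v 0 -> u 1 = v 1 ->
  path_homotopic (f \o u) (f \o v).
Proof.
move=> [cf _ _] cu cv uv01; apply: (htp_reparam cf) => //.
  move=> s t c /=; rewrite !in_itv /= => /andP[s0 s1] /andP[t0 t1] /andP[c0 c1].
  by apply/andP; split; nra.
Qed.

Lemma continuous_if (c : R) (u v : R -> R) : u c = v c ->
  continuous u -> continuous v ->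
  continuous (fun t : R => if t <= c then u t else v t).
Proof.
move=> uv cu cv; apply/continuous_subspace_setT.
apply: (@paste_continuous _ _ _ _ id) => //; [exact: continuous_subspaceT..|].
by move=> t _ ->.
Qed.

Lemma htp_cstl x y f : is_path x y f -> path_homotopic (path_cat (cst x) f) f.
Proof.
move=> fP; have [_ f0 _] := fP.
pose u (t : R) := if t <= 2^-1 then 0 * t + 0 else 2 * t + (- 1).
apply: (@htp_trans _ (f \o u)).
  apply: htp_eq; first by apply: is_path_cat fP; exact: is_path_cst.
  by move=> t _; rewrite /path_cat /u /=; case: ifP => // _; rewrite mul0r addr0 f0.
apply: (@htp_reparam01 _ _ _ _ id fP) => //.
- by apply: continuous_if; [field|exact: affine_continuous..].
- by move=> t /andP[? ?]; rewrite /u; case: ifPn => ?; lra.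
- by rewrite /u; case: ifPn => ?; lra.
- by rewrite /u; case: ifPn => ?; lra.
Qed.

Lemma htp_revr x y f : is_path x y f ->
  path_homotopic (path_cat f (path_rev f)) (cst x).
Proof.
move=> fP; have [_ f0 _] := fP.
pose u (t : R) := if t <= 2^-1 then 2 * t + 0 else (- 2) * t + 2.
apply: (@htp_trans _ (f \o u)).
  apply: htp_eq; first by apply: is_path_cat fP (is_path_rev fP).
  by move=> t _; rewrite /path_cat /path_rev /u /=; case: ifP => _; congr f; ring.
rewrite [X in path_homotopic _ X](_ : _ = f \o (fun t => 0 * t + 0)); last first.
  by apply/funext => t /=; rewrite mul0r addr0 f0.
apply: (@htp_reparam01 _ _ _ _ _ fP) => //.
- by apply: continuous_if; [field|exact: affine_continuous..].
- exact: affine_continuous.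
- by move=> t /andP[? ?]; rewrite /u; case: ifPn => ?; lra.
- by rewrite /u; case: ifPn => ?; lra.
- by rewrite /u; case: ifPn => ?; lra.
Qed.

Lemma htp_cat_assoc w x y z f g h :
  is_path w x f -> is_path x y g -> is_path y z h ->
  path_homotopic (path_cat f (path_cat g h)) (path_cat (path_cat f g) h).
Proof.
move=> fP gP hP.
have fghP := is_path_cat (is_path_cat fP gP) hP.
(* [u] sends the times at which [f], [g] and [h] are run in the first
   concatenation to the times at which they are run in the second. *)
pose v (t : R) := if t <= 3 / 4 then 1 * t + - (1 / 4) else 2 * t + - 1.
pose u (t : R) := if t <= 2^-1 then (1 / 2) * t + 0 else v t.
have cu : continuous u.
  apply: continuous_if; [|exact: affine_continuous|].
    by rewrite /v; case: ifPn => ?; lra.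
  by apply: continuous_if; [field|exact: affine_continuous..].
apply: (@htp_trans _ (path_cat (path_cat f g) h \o u)); last first.
  apply: (@htp_reparam01 _ _ _ u id fghP) => //.
  - move=> t /andP[? ?]; rewrite /u; case: ifPn => ?; first by lra.
    by rewrite /v; case: ifPn => ?; lra.
  - by rewrite /u; case: ifPn => ?; lra.
  - rewrite /u; case: ifPn => ?; first by lra.
    by rewrite /v; case: ifPn => ?; lra.
apply: htp_eq; first exact: is_path_cat fP (is_path_cat gP hP).
move=> t _; rewrite /path_cat /u /v /=.
have [t2|t2] := leP t 2^-1.
  have -> : (1 / 2 * t + 0 <= 2^-1) by lra.
  have -> : (2 * (1 / 2 * t + 0) <= 2^-1) by lra.
  by congr f; field.
have [t4|t4] := leP t (3 / 4).
  have -> : 2 * t - 1 <= 2^-1 by lra.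
  have -> : 1 * t + - (1 / 4) <= 2^-1 by lra.
  have -> : (2 * (1 * t + - (1 / 4)) <= 2^-1) = false by apply/negbTE; lra.
  by congr g; field.
have -> : (2 * t - 1 <= 2^-1) = false by apply/negbTE; lra.
by congr h; field.
Qed.

End homotopy.

Lemma affineR_continuous (R : realType) (a b : R) :
  continuous (fun t : R => a * t + b).
Proof. by apply: affine_continuous => t; exact: cvg_id. Qed.

(** * The fundamental group *)

Section path_classes.
Context {R : realType} {T : topologicalType}.
Implicit Types (f g h : R -> T) (w x y z : T).

(** Indexing the classes by both endpoints makes composition total, so the
    groupoid laws become equations without side conditions. *)
Definition path_class x y := {A : set (R -> T) |
  exists2 f, is_path x y f & A = path_homotopic f}.

Definition class_of x y f (fP : is_path x y f) : path_class x y :=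
  exist _ (path_homotopic f) (ex_intro2 _ _ f fP erefl).

Lemma class_of_eq x y f g (fP : is_path x y f) (gP : is_path x y g) :
  path_homotopic f g -> class_of fP = class_of gP.
Proof.
move=> fg; apply: eq_exist => /=; apply/seteqP; split => h.
  exact: htp_trans (htp_sym fg).
exact: htp_trans fg.
Qed.

Lemma path_classP x y (a : path_class x y) :
  exists f (fP : is_path x y f), a = class_of fP.
Proof. by case: a => A [f fP Af]; exists f, fP; exact: eq_exist. Qed.

Definition class_rep x y (a : path_class x y) : R -> T := sval (cid2 (svalP a)).

Lemma class_rep_path x y (a : path_class x y) : is_path x y (class_rep a).
Proof. by rewrite /class_rep; case: cid2. Qed.

Lemma class_rep_htp x y f (fP : is_path x y f) :
  path_homotopic f (class_rep (class_of fP)).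
Proof.
rewrite /class_rep; case: cid2 => g gP /= ->; exact: htp_refl gP.
Qed.

Definition class_cat x y z (a : path_class x y) (b : path_class y z) :=
  class_of (is_path_cat (class_rep_path a) (class_rep_path b)).

Definition class_rev x y (a : path_class x y) :=
  class_of (is_path_rev (class_rep_path a)).

Definition class_cst x := class_of (@is_path_cst R T x).

Lemma class_catE x y z f g (fP : is_path x y f) (gP : is_path y z g) :
  class_cat (class_of fP) (class_of gP) = class_of (is_path_cat fP gP).
Proof.
apply: class_of_eq; apply: htp_cat.
- have [_ _ ->] := class_rep_path (class_of fP).
  by have [_ -> _] := class_rep_path (class_of gP).
- exact: htp_sym (class_rep_htp _).
- exact: htp_sym (class_rep_htp _).
Qed.

Lemma class_revE x y f (fP : is_path x y f) :
  class_rev (class_of fP) = class_of (is_path_rev fP).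
Proof. exact/class_of_eq/htp_rev/htp_sym/class_rep_htp. Qed.

Lemma class_catA w x y z (a : path_class w x) (b : path_class x y)
    (c : path_class y z) :
  class_cat a (class_cat b c) = class_cat (class_cat a b) c.
Proof.
have [f [fP ->]] := path_classP a; have [g [gP ->]] := path_classP b.
have [h [hP ->]] := path_classP c.
by rewrite !class_catE; exact/class_of_eq/(htp_cat_assoc fP gP hP).
Qed.

Lemma class_cat1l x y (a : path_class x y) : class_cat (class_cst x) a = a.
Proof.
have [f [fP ->]] := path_classP a.
by rewrite class_catE; exact/class_of_eq/(htp_cstl fP).
Qed.

Lemma class_catV x y (a : path_class x y) :
  class_cat a (class_rev a) = class_cst x.
Proof.
have [f [fP ->]] := path_classP a.
by rewrite class_revE class_catE; exact/class_of_eq/(htp_revr fP).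
Qed.

Lemma class_revK x y (a : path_class x y) : class_rev (class_rev a) = a.
Proof.
have [f [fP ->]] := path_classP a; rewrite !class_revE; apply: class_of_eq.
apply: htp_sym; apply: htp_eq fP _ => t _.
by rewrite /path_rev subKr.
Qed.

Lemma class_Vcat x y (a : path_class x y) :
  class_cat (class_rev a) a = class_cst y.
Proof. by rewrite -{2}(class_revK a) class_catV. Qed.

Lemma class_cat1r x y (a : path_class x y) : class_cat a (class_cst y) = a.
Proof. by rewrite -(class_Vcat a) class_catA class_catV class_cat1l. Qed.

End path_classes.

Definition pi1 (R : realType) (T : topologicalType) (p : T) :=
  @path_class R T p p.

HB.instance Definition _ (R : realType) (T : topologicalType) (p : T) :=
  gen_eqMixin (@pi1 R T p).
HB.instance Definition _ (R : realType) (T : topologicalType) (p : T) :=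
  gen_choiceMixin (@pi1 R T p).
HB.instance Definition _ (R : realType) (T : topologicalType) (p : T) :=
  isGroup.Build (@pi1 R T p) (@class_catA R T p p p p) (@class_cat1l R T p p)
    (@class_cat1r R T p p) (@class_Vcat R T p p) (@class_catV R T p p).

(** * Quotient of a group by a normal subgroup *)

Record normal_subgroup (G : groupType) := NormalSubgroup {
  normal_set :> G -> Prop;
  normal_one : normal_set 1%g;
  normal_mul : forall a b, normal_set a -> normal_set b -> normal_set (a * b)%g;
  normal_inv : forall a, normal_set a -> normal_set (a^-1)%g;
  normal_conj : forall a b, normal_set a -> normal_set (b * a * b^-1)%g
}.

Section quotient.
Local Open Scope group_scope.
Local Open Scope quotient_scope.
Context (G : groupType) (N : normal_subgroup G).
Implicit Types a b c : G.

Definition coset_rel a b : bool := `[< N (a * b^-1) >].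

Lemma coset_rel_equiv : equiv_class_of coset_rel.
Proof.
split=> [a|a b|b a c]; rewrite /coset_rel.
- by apply/asboolP; rewrite mulgV; exact: normal_one.
- by apply/asboolP/asboolP => /normal_inv; rewrite invgM invgK.
- move=> /asboolP ab /asboolP bc; apply/asboolP.
  by have := normal_mul ab bc; rewrite mulgA mulgVK.
Qed.

Canonical coset_equiv := EquivRelPack coset_rel_equiv.

Definition quotient_group := {eq_quot coset_equiv}.
HB.instance Definition _ := Choice.on quotient_group.

Definition quo a : quotient_group := \pi_({eq_quot coset_equiv}) a.
Let rep (q : quotient_group) : G := repr (q : {eq_quot coset_equiv}).

Lemma quo_eq a b : quo a = quo b <-> N (a * b^-1).
Proof.
split=> [/eqmodP /asboolP //|Nab].
by apply/eqmodP; apply/asboolP.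
Qed.

Lemma quo_rep q : quo (rep q) = q. Proof. exact: reprK. Qed.

Let quoE q : exists a, q = quo a. Proof. by exists (rep q); rewrite quo_rep. Qed.

Definition quo_mul q r := quo (rep q * rep r).
Definition quo_inv q := quo (rep q)^-1.

Lemma quo_mulE a b : quo_mul (quo a) (quo b) = quo (a * b).
Proof.
have /quo_eq Na := quo_rep (quo a); have /quo_eq Nb := quo_rep (quo b).
apply/quo_eq; have := normal_mul (normal_conj (rep (quo a)) Nb) Na.
by rewrite invgM !mulgA mulgVK.
Qed.

Lemma quo_invE a : quo_inv (quo a) = quo a^-1.
Proof.
have /quo_eq Na := quo_rep (quo a); apply/quo_eq.
have := normal_conj (rep (quo a))^-1 (normal_inv Na).
by rewrite invgM !invgK !mulgA mulgVK.
Qed.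

Let quo_mulA : associative quo_mul.
Proof.
move=> q r s; have [[a ->] [b ->] [c ->]] := And3 (quoE q) (quoE r) (quoE s).
by rewrite !quo_mulE mulgA.
Qed.

Let quo_mul1 : left_id (quo 1) quo_mul.
Proof. by move=> q; have [a ->] := quoE q; rewrite quo_mulE mul1g. Qed.

Let quo_1mul : right_id (quo 1) quo_mul.
Proof. by move=> q; have [a ->] := quoE q; rewrite quo_mulE mulg1. Qed.

Let quo_Vmul : left_inverse (quo 1) quo_inv quo_mul.
Proof. by move=> q; have [a ->] := quoE q; rewrite quo_invE quo_mulE mulVg. Qed.

Let quo_mulV : right_inverse (quo 1) quo_inv quo_mul.
Proof. by move=> q; have [a ->] := quoE q; rewrite quo_invE quo_mulE mulgV. Qed.

HB.instance Definition _ := isGroup.Build quotient_group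
  quo_mulA quo_mul1 quo_1mul quo_Vmul quo_mulV.

Lemma quoM a b : quo (a * b) = quo a * quo b.
Proof. by rewrite -quo_mulE. Qed.

Lemma quo1 a : quo a = 1 <-> N a.
Proof. by rewrite -[X in _ <-> N X]mulg1 -[X in _ * X]invg1; exact: quo_eq. Qed.

End quotient.

(** * Classes of paths modulo a normal subgroup of the fundamental group *)

Section holonomy.
Local Open Scope group_scope.
Context {R : realType} {T : topologicalType} (p : T).
Hypothesis T_conn : path_connected R T.
Variables (H : set (R -> T)) (H_normal : pi1_normal_subgroup p H).
Implicit Types (f g h : R -> T) (x y z : T).

Definition subgroup_classes : set (pi1 R p) := [set a | sval a `<=` H].

(** A class meets [H] only if it is contained in [H], by homotopy invariance. *)
Lemma subgroup_classesE f (fP : is_path p p f) :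
  subgroup_classes (class_of fP) <-> H f.
Proof.
split=> [|Hf g]; first by apply; exact: htp_refl fP.
exact: pi1_homotopic H_normal _ _ Hf.
Qed.

Lemma subgroup_classes1 : subgroup_classes 1.
Proof. by apply/subgroup_classesE; exact: pi1_one H_normal. Qed.

Lemma subgroup_classesM (a b : pi1 R p) :
  subgroup_classes a -> subgroup_classes b -> subgroup_classes (a * b).
Proof.
have [f [fP ->]] := path_classP a; have [g [gP ->]] := path_classP b.
move=> /subgroup_classesE Hf /subgroup_classesE Hg.
rewrite [_ * _]class_catE; apply/subgroup_classesE.
exact: pi1_mul H_normal _ _ Hf Hg.
Qed.

Lemma subgroup_classesV (a : pi1 R p) :
  subgroup_classes a -> subgroup_classes a^-1.
Proof.
have [f [fP ->]] := path_classP a => /subgroup_classesE Hf.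
rewrite [_^-1]class_revE; apply/subgroup_classesE.
exact: pi1_inv H_normal _ Hf.
Qed.

Lemma subgroup_classesJ (a b : pi1 R p) :
  subgroup_classes a -> subgroup_classes (b * a * b^-1).
Proof.
have [f [fP ->]] := path_classP a; have [g [gP ->]] := path_classP b.
move=> /subgroup_classesE Hf.
rewrite [_^-1]class_revE [X in X * _]class_catE [_ * _]class_catE.
apply/subgroup_classesE; exact: pi1_conj H_normal _ _ Hf gP.
Qed.

Definition normal_classes := NormalSubgroup subgroup_classes1
  subgroup_classesM subgroup_classesV subgroup_classesJ.

Definition holo_group := quotient_group normal_classes.

Definition base_path x : R -> T := sval (cid (T_conn p x)).

Lemma base_pathP x : is_path p x (base_path x).
Proof. exact: (svalP (cid (T_conn p x))). Qed.

Let base x := class_of (base_pathP x).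

Definition based_class x y (a : path_class x y) : pi1 R p :=
  class_cat (class_cat (base x) a) (class_rev (base y)).

Definition holo f : holo_group :=
  if pselect (is_path (f 0) (f 1%R) f) is left fP
  then quo normal_classes (based_class (class_of fP)) else 1.

Lemma holoE x y f (fP : is_path x y f) :
  holo f = quo normal_classes (based_class (class_of fP)).
Proof.
have [_ fx fy] := fP; subst x y; rewrite /holo; case: pselect => // fP'.
by rewrite (Prop_irrelevance fP' fP).
Qed.

(** The chosen path to the middle point is run back and forth, and cancels. *)
Lemma based_class_cat x y z (a : path_class x y) (b : path_class y z) :
  based_class (class_cat a b) = based_class a * based_class b.
Proof.
rewrite [RHS]class_catA; congr class_cat.
rewrite !class_catA -[in RHS](class_catA _ (class_rev _) (base y)).
by rewrite class_Vcat class_cat1r.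
Qed.

Lemma holo_cat x y z f g : is_path x y f -> is_path y z g ->
  holo (path_cat f g) = holo f * holo g.
Proof.
move=> fP gP; rewrite (holoE fP) (holoE gP) (holoE (is_path_cat fP gP)).
by rewrite -quoM -based_class_cat class_catE.
Qed.

Lemma holo_htp x y f g : is_path x y f -> path_homotopic f g -> holo f = holo g.
Proof.
move=> fP fg; have gP := htp_path fP fg; rewrite (holoE fP) (holoE gP).
by rewrite (class_of_eq fP gP fg).
Qed.

(** Two paths from [p] to [x] differ by a loop at [p], which conjugates one
    closed-up loop into the other, and [H] is normal. *)
Lemma holo_loop x f alpha : is_path x x f -> is_path p x alpha ->
  (holo f = 1 <-> H (path_cat (path_cat alpha f) (path_rev alpha))).
Proof.
move=> fP aP; rewrite (holoE fP) quo1.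
set a := class_of aP; set c := class_of fP.
pose k : pi1 R p := class_cat a (class_rev (base x)).
pose d : pi1 R p := class_cat (class_cat a c) (class_rev a).
have dE : d = k * based_class c * k^-1.
  rewrite -[LHS](mulgK k); congr (_ * _).
  rewrite [LHS]class_catA [RHS]class_catA /k; congr class_cat.
  rewrite !class_catA -[in LHS](class_catA _ (class_rev _) a).
  rewrite class_Vcat class_cat1r -[in RHS](class_catA _ (class_rev _) (base x)).
  by rewrite class_Vcat class_cat1r.
rewrite -(subgroup_classesE (is_path_cat (is_path_cat aP fP) (is_path_rev aP))).
rewrite -!class_catE -class_revE -/d dE; split=> [|].
  exact: (@normal_conj _ normal_classes).
move=> /(@normal_conj _ normal_classes _ k^-1).
by rewrite invgK !mulgA mulVg mul1g mulgVK.
Qed.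

End holonomy.

(** * Transport modulo loops in balls *)

Section delta_subgroup.
Context {R : realType} {X : metricType R} (p : X).

Lemma delta_loops_loop (delta : R) f : delta_loops delta p f -> is_loop p f.
Proof.
move=> [al [be [x [alP beP _ ->]]]].
exact: is_path_cat (is_path_cat alP beP) (is_path_rev alP).
Qed.

(** With this, the intersection that defines [pi1_delta] is not over the empty
    family, so it consists of loops. *)
Lemma all_loops_normal : pi1_normal_subgroup p (@is_loop R X p).
Proof.
split=> //.
- by move=> f g; exact: htp_path.
- exact: is_path_cst.
- by move=> f g; exact: is_path_cat.
- by move=> f; exact: is_path_rev.
- by move=> f g fP gP; exact: is_path_cat (is_path_cat gP fP) (is_path_rev gP).
Qed.

Lemma pi1_delta_normal (delta : R) :
  pi1_normal_subgroup p (pi1_delta delta p).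
Proof.
split.
- move=> f /(_ (@is_loop R X p)); apply; split; first exact: all_loops_normal.
  exact: delta_loops_loop.
- by move=> f g Hf fg A AP; have [? h _ _ _ _] := AP.1; apply: h fg; exact: Hf.
- by move=> A [[]].
- move=> f g Hf Hg A AP; have [_ _ _ h _ _] := AP.1.
  by apply: h; [exact: Hf|exact: Hg].
- by move=> f Hf A AP; have [_ _ _ _ h _] := AP.1; apply: h; exact: Hf.
- by move=> f g Hf gP A AP; have [_ _ _ _ _ h] := AP.1; apply: h => //; exact: Hf.
Qed.

Lemma delta_loops_le (delta delta' : R) : delta <= delta' ->
  delta_loops delta p `<=` delta_loops delta' p.
Proof.
move=> dd f [al [be [x [alP beP be_ball ->]]]]; exists al, be, x; split=> // t t01.
exact: le_ball dd _ (be_ball t t01).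
Qed.

(** Without a new loop the two subgroups would coincide, and then so would the
    covers chosen for them. *)
Lemma CovSpec_new_loop (delta delta' : R) :
  CovSpec p delta -> delta < delta' ->
  exists f, delta_loops delta' p f /\ ~ pi1_delta delta p f.
Proof.
move=> [_ h] dd; apply: contrapT => nf; apply: (h _ dd).
have E : pi1_delta delta p = pi1_delta delta' p.
  apply/seteqP; split.
    apply: sub_smallest2r => [|f]; first exact: pi1_delta_normal.
    apply: (@delta_loops_le _ _ (ltW dd)).
  apply: smallest_sub; first exact: pi1_delta_normal.
  by move=> f f'; apply: contrapT => nHf; apply: nf; exists f.
rewrite /delta_cover E; exists id, id; split=> //.
- by split=> // x; exact: cvg_id.
- by split=> // x; exact: cvg_id.
Qed.

End delta_subgroup.

(** The properties of parallel transport in the [delta]-cover that the metric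
    arguments use. It is a group-valued function of a curve [f] and of two times
    in either order; for curves that are not closed it depends on choices at
    the endpoints. *)
Record transport (R : realType) (X : metricType R) (delta : R) := Transport {
  tr_group : groupType;
  tr : (R -> X) -> R -> R -> tr_group;
  tr_cat : forall f a b c, continuous f ->
    (tr f a b * tr f b c)%g = tr f a c;
  tr_affine : forall f u v a b,
    tr (fun t => f (u * t + v)) a b = tr f (u * a + v) (u * b + v);
  tr_eq : forall f g a b, continuous f -> a <= b ->
    (forall t, a <= t <= b -> f t = g t) -> tr f a b = tr g a b;
  tr_ball : forall f a b x, continuous f -> a <= b -> f a = f b ->
    (forall t, a <= t <= b -> ball x delta (f t)) -> tr f a b = 1%g
}.

Section transport_construction.
Context {R : realType} {X : metricType R} (p : X) (delta : R).
Hypothesis X_conn : path_connected R X.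
Implicit Types (f g : R -> X).

Definition segment f (a b : R) : R -> X := fun t => f (a + t * (b - a)).

Let aff (a b : R) : continuous (fun t : R => a + t * (b - a)).
Proof.
move=> t; apply: cvgD; first exact: cvg_cst.
by apply: cvgM; [exact: cvg_id|exact: cvg_cst].
Qed.

Lemma segment_path f a b : continuous f -> is_path (f a) (f b) (segment f a b).
Proof.
move=> cf; split; rewrite /segment ?mul0r ?addr0 ?mul1r ?addrNK ?subrKC //.
apply: continuous_subspaceT => t.
by apply: (@continuous_comp _ _ _ (fun t : R => a + t * (b - a)) f); [exact: aff|exact: cf].
Qed.

Let trX f a b := holo X_conn (pi1_delta_normal p delta) (segment f a b).

Lemma segment_cat f a b c : continuous f ->
  path_homotopic (path_cat (segment f a b) (segment f b c)) (segment f a c).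
Proof.
move=> cf.
pose u (t : R) := if t <= 2^-1 then 2 * (b - a) * t + a
                  else 2 * (c - b) * t + (2 * b - c).
have -> : path_cat (segment f a b) (segment f b c) = f \o u.
  by apply/funext => t; rewrite /path_cat /segment /u /=; case: ifP => _; congr f; ring.
apply: (@htp_reparam _ _ setT f u (fun t => a + t * (c - a))) => //.
- exact: continuous_subspaceT.
- by apply: continuous_if; [field|exact: affineR_continuous..].
- by rewrite /u; case: ifPn => ?; lra.
- by rewrite /u; case: ifPn => ?; lra.
Qed.

Let trX_cat f a b c : continuous f -> (trX f a b * trX f b c)%g = trX f a c.
Proof.
move=> cf; have abP := segment_path a b cf; have bcP := segment_path b c cf.
rewrite /trX -(holo_cat _ _ abP bcP).
exact: holo_htp (is_path_cat abP bcP) (segment_cat _ _ _ cf).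
Qed.

Let trX_affine f u v a b :
  trX (fun t => f (u * t + v)) a b = trX f (u * a + v) (u * b + v).
Proof.
by rewrite /trX; congr holo; apply/funext => t; rewrite /segment; congr f; ring.
Qed.

Let in_segment (a b t : R) : a <= b -> 0 <= t <= 1 -> a <= a + t * (b - a) <= b.
Proof. by move=> ab /andP[t0 t1]; apply/andP; split; nra. Qed.

Let trX_eq f g a b : continuous f -> a <= b ->
  (forall t, a <= t <= b -> f t = g t) -> trX f a b = trX g a b.
Proof.
move=> cf ab fg; have abP := segment_path a b cf.
apply: (holo_htp _ _ abP); apply: (htp_eq abP) => t t01.
by apply: fg; exact: in_segment.
Qed.

Let delta_loop_sub f : delta_loops delta p f -> pi1_delta delta p f.
Proof. by apply: sub_smallest. Qed.

Let trX_ball f a b x : continuous f -> a <= b -> f a = f b ->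
  (forall t, a <= t <= b -> ball x delta (f t)) -> trX f a b = 1%g.
Proof.
move=> cf ab fab fball; have abP := segment_path a b cf; rewrite -fab in abP.
have [al alP] := X_conn p (f a).
apply/(holo_loop _ _ abP alP); apply: delta_loop_sub.
exists al, (segment f a b), x; have [_ -> _] := abP.
by split=> // t t01; apply: fball; exact: in_segment.
Qed.

(** The converse of [tr_ball]: trivial transport detects membership in the
    subgroup generated by the loops in small balls. *)
Lemma pi1_delta_transport : exists W : transport X delta,
  forall al be : R -> X, continuous be -> is_path p (be 0) al -> be 0 = be 1 ->
    tr W be 0 1 = 1%g ->
    pi1_delta delta p (path_cat (path_cat al be) (path_rev al)).
Proof.
exists (Transport trX_cat trX_affine trX_eq trX_ball) => al be cbe alP be01 /=.
have segE : segment be 0 1 = be.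
  by apply/funext => t; rewrite /segment add0r subr0 mulr1.
have beP := segment_path 0 1 cbe; rewrite segE -be01 in beP.
by rewrite /trX segE => /(holo_loop _ _ beP alP).
Qed.

End transport_construction.

(** * Lipschitz curves *)

Section lipschitz.
Context {R : realType} {X : metricType R}.
Implicit Types (f g : R -> X) (K : R).

Definition lipschitz_curve K f := forall s t, mdist (f s) (f t) <= K * `|s - t|.

Lemma lipschitz_curveP K f :
  (forall s t, s <= t -> mdist (f s) (f t) <= K * (t - s)) -> lipschitz_curve K f.
Proof.
move=> h s t; have [st|/ltW st] := leP s t.
  by rewrite distrC ger0_norm ?subr_ge0 // h.
by rewrite ger0_norm ?subr_ge0 // metric_sym h.
Qed.

Lemma lipschitz_curve_le K f s t : lipschitz_curve K f -> s <= t ->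
  mdist (f s) (f t) <= K * (t - s).
Proof. by move=> h st; rewrite -(ger0_norm (x := t - s)) ?subr_ge0 // distrC. Qed.

Lemma lipschitz_curve_ge0 K f : lipschitz_curve K f -> 0 <= K.
Proof.
move=> /(_ 1 0); rewrite subr0 normr1 mulr1; exact: le_trans (mdist_ge0 _ _).
Qed.

Lemma lipschitz_curve_continuous K f : lipschitz_curve K f -> continuous f.
Proof.
move=> h t; have K0 := lipschitz_curve_ge0 h.
apply/cvg_ballP => e e0.
have eK : 0 < e / (K + 1) by rewrite divr_gt0 // ltr_wpDl.
near=> s; rewrite ballEmdist /=; apply: le_lt_trans (h t s) _.
have : `|t - s| < e / (K + 1).
  near: s; exact: (nbhsx_ballx t _ eK).
rewrite ltr_pdivlMr ?ltr_wpDl // mulrDr mulr1 mulrC => /le_lt_trans; apply.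
by rewrite lerDl.
Unshelve. all: by end_near. Qed.

Lemma lipschitz_curve_affine K f (u v : R) : lipschitz_curve K f ->
  lipschitz_curve (K * `|u|) (fun t => f (u * t + v)).
Proof.
move=> h s t; apply: le_trans (h _ _) _.
by rewrite opprD addrACA subrr addr0 -mulrBr normrM mulrA.
Qed.

Lemma lipschitz_curveW K K' f : K <= K' -> lipschitz_curve K f ->
  lipschitz_curve K' f.
Proof. by move=> KK' h s t; apply: le_trans (h s t) _; exact: ler_wpM2r. Qed.

Definition join f g (b : R) : R -> X := fun t => if t <= b then f t else g t.

Lemma join_continuous f g b : continuous f -> continuous g -> f b = g b ->
  continuous (join f g b).
Proof.
move=> cf cg fg; apply/continuous_subspace_setT.
apply: (@paste_continuous _ _ _ _ id) => //.
- by move=> t; exact: cvg_id.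
- exact: continuous_subspaceT.
- exact: continuous_subspaceT.
- by move=> t _ ->.
Qed.

Lemma join_lipschitz K f g b : lipschitz_curve K f -> lipschitz_curve K g ->
  f b = g b -> lipschitz_curve K (join f g b).
Proof.
move=> hf hg fg; apply: lipschitz_curveP => s t st; rewrite /join.
have [tb|bt] := leP t b; first by rewrite (le_trans st tb) lipschitz_curve_le.
have [sb|bs] := leP s b; last exact: lipschitz_curve_le.
apply: le_trans (metric_triangle _ (f b) _) _.
have h1 := lipschitz_curve_le hf sb.
have h2 := lipschitz_curve_le hg (ltW bt); rewrite -fg in h2.
apply: le_trans (lerD h1 h2) _; rewrite -mulrDr; apply: ler_wpM2l; last lra.
exact: lipschitz_curve_ge0 hf.
Qed.

End lipschitz.

(** * Length of curves *)

Section length.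
Context {R : realType} {X : metricType R}.
Implicit Types (g : R -> X) (a b c : R) (s t : seq R).

Fixpoint polygon_length g a s : R :=
  if s is x :: s' then mdist (g a) (g x) + polygon_length g x s' else 0.

Lemma curve_lengthE g a b : curve_length g a b =
  ereal_sup [set (polygon_length g a s)%:E | s in itv_partition a b].
Proof.
rewrite /curve_length; congr ereal_sup; apply: eq_imagel => s _; congr _%:E.
elim: s a => [a|x s IH a] /=; first by rewrite big_nil.
by rewrite big_nat_recl //= IH.
Qed.

Lemma polygon_length_cat g a s t : polygon_length g a (s ++ t) =
  polygon_length g a s + polygon_length g (last a s) t.
Proof.
by elim: s a => [a|x s IH a] /=; rewrite ?add0r // IH addrA.
Qed.

Lemma polygon_length_le g K a s : lipschitz_curve K g -> path <%R a s ->
  polygon_length g a s <= K * (last a s - a).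
Proof.
move=> h; elim: s a => [a _|x s IH a /= /andP[ax xs]].
  by rewrite subrr mulr0.
have h1 := lipschitz_curve_le h (ltW ax); have h2 := IH _ xs.
by apply: le_trans (lerD h1 h2) _; rewrite -mulrDr addrC subrKA.
Qed.

Definition inscribed g a b (r : R) :=
  exists2 s, itv_partition a b s & polygon_length g a s = r.

Lemma inscribed_mdist g a b : a <= b -> inscribed g a b (mdist (g a) (g b)).
Proof.
rewrite le_eqVlt => /predU1P[->|ab].
  by exists [::]; [split|rewrite mdistxx].
by exists [:: b]; [exact: itv_partition1|rewrite /= addr0].
Qed.

Lemma inscribed_cat g a b c (r r' : R) :
  inscribed g a b r -> inscribed g b c r' -> inscribed g a c (r + r').
Proof.
move=> [s sP <-] [t tP <-]; exists (s ++ t); first exact: itv_partition_cat sP tP.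
by rewrite polygon_length_cat; case: sP => _ /eqP ->.
Qed.

Lemma inscribed_le g a b r : inscribed g a b r -> (r%:E <= curve_length g a b)%E.
Proof.
by move=> [s sP <-]; rewrite curve_lengthE; apply: ereal_sup_ubound; exists s.
Qed.

Lemma mdist_le_length g a b : a <= b ->
  ((mdist (g a) (g b))%:E <= curve_length g a b)%E.
Proof. by move=> ab; exact/inscribed_le/inscribed_mdist. Qed.

Lemma lipschitz_length_le g K a b : lipschitz_curve K g ->
  (curve_length g a b <= (K * (b - a))%:E)%E.
Proof.
move=> h; rewrite curve_lengthE; apply: ge_ereal_sup => _ [s [sP /eqP sb] <-].
by rewrite lee_fin -[X in X - a]sb; exact: polygon_length_le.
Qed.

(** A polygon with sides below the scale [e] already attains the upper bound
    that the Lipschitz constant puts on the length. *)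
Lemma local_isometry_length g K e a b : 0 < e -> lipschitz_curve K g ->
  (forall u v, u <= v -> v - u <= e -> mdist (g u) (g v) = K * (v - u)) ->
  a <= b -> curve_length g a b = (K * (b - a))%:E.
Proof.
move=> e0 h iso ab; apply/eqP; rewrite eq_le lipschitz_length_le //=.
apply: inscribed_le.
(* Cut off arcs of length [e] from the right end, [n] times. *)
have small n c d : c <= d -> d - c <= n%:R * e -> inscribed g c d (K * (d - c)).
  elim: n c d => [c d cd|n IH c d cd].
    rewrite mul0r => dc; have -> : d = c by lra.
    by exists [::]; [split|rewrite subrr mulr0].
  rewrite -natr1 mulrDl mul1r => dc.
  have [dce|dce] := leP (d - c) e.
    by rewrite -(iso _ _ cd dce); exact: inscribed_mdist.
  have -> : K * (d - c) = K * (d - e - c) + K * (d - (d - e)) by ring.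
  apply: (@inscribed_cat _ _ (d - e)).
    by apply: IH; lra.
  rewrite -iso; [|lra..]; apply: inscribed_mdist; lra.
have ba0 : 0 <= (b - a) / e by rewrite divr_ge0 ?subr_ge0 // ltW.
apply: (small (Num.bound ((b - a) / e))) => //.
by rewrite -ler_pdivrMr // ltW // archi_boundP.
Qed.

End length.

(** * Geodesics in length spaces *)

Section geodesics.
Context {R : realType} {X : metricType R}.

Lemma mdist_continuous (x : X) : continuous (mdist x : X -> R).
Proof.
move=> y; apply/(@cvg_ballP R R) => e e0; near=> z.
rewrite /ball /= ltr_distl; apply/andP.
have yz : mdist y z < e by near: z; move: (nbhsx_ballx y _ e0); rewrite ballEmdist.
have h1 := metric_triangle x z y; have h2 := metric_triangle x y z.
by rewrite (metric_sym z y) in h1; split; lra.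
Unshelve. all: by end_near. Qed.

(** Reparametrizing a shortest path by its distance to the starting point
    makes it 1-Lipschitz; it is extended by constants outside its domain. *)
Lemma length_space_geodesic (x y : X) : length_space X ->
  exists c : R -> X, [/\ c 0 = x, c (mdist x y) = y & lipschitz_curve 1 c].
Proof.
move=> /(_ x y) [c [[cc c0 c1] cL]]; set D := mdist x y in cL *.
have D0 : 0 <= D by exact: mdist_ge0.
(* On a shortest path the distance to [x] grows as fast as possible. *)
have add s t : 0 <= s -> s <= t -> t <= 1 ->
    mdist (c s) (c t) <= mdist x (c t) - mdist x (c s).
  move=> s0 st t1.
  have := inscribed_le (inscribed_cat (inscribed_cat (inscribed_mdist c s0)
    (inscribed_mdist c st)) (inscribed_mdist c t1)).
  rewrite cL lee_fin c0 c1 => h; have := metric_triangle x (c t) y.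
  by rewrite -/D; lra.
have ch : {within `[0, 1], continuous (fun t => mdist x (c t))}.
  apply: (within_comp (A := setT) cc); last by [].
  by apply: continuous_subspaceT; exact: mdist_continuous.
have ivt v : 0 <= v <= D -> exists s, 0 <= s <= 1 /\ mdist x (c s) = v.
  move=> vD; have [|s] := @IVT R _ 0 1 v ler01 ch.
    by rewrite c0 c1 mdistxx min_l // max_r.
  by rewrite in_itv /= => s01 <-; exists s.
(* The projection of the line to [0, D]. *)
pose cl (v : R) := if v <= 0 then 0 else if v <= D then v else D.
have cl0 : cl 0 = 0 by rewrite /cl lexx.
have clD : cl D = D.
  by rewrite /cl lexx; case: ifPn => // D0'; apply/eqP; rewrite eq_le D0 D0'.
have clP v : 0 <= cl v <= D.
  by rewrite /cl; case: ifPn => ?; [|case: ifPn => ?]; lra.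
have cl_lip u v : u <= v -> 0 <= cl v - cl u <= v - u.
  by move=> uv; rewrite /cl; do !case: ifPn => ?; lra.
(* At time [sig v] the path is at distance [cl v] from [x]. *)
have [sig sigP] := choice (fun v => ivt _ (clP v)).
have sig_dist u v : cl u <= cl v -> mdist (c (sig u)) (c (sig v)) <= cl v - cl u.
  have [/andP[u0 u1] uE] := sigP u; have [/andP[v0 v1] vE] := sigP v.
  rewrite -uE -vE => uv; have [suv|/ltW svu] := leP (sig u) (sig v).
    exact: add.
  by have := add _ _ v0 svu u1; rewrite metric_sym; lra.
exists (c \o sig); split=> /=.
- by have [_] := sigP 0; rewrite cl0 => /mdist_positivity.
- have [/andP[s0 s1] sE] := sigP D; have := add _ _ s0 s1 (lexx _).
  rewrite sE clD c1 subrr => h; apply: mdist_positivity; apply/eqP.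
  by rewrite eq_le h mdist_ge0.
- apply: lipschitz_curveP => u v uv; rewrite mul1r.
  have /andP[h1 h2] := cl_lip u v uv.
  by apply: le_trans (sig_dist u v _) h2; rewrite -subr_ge0.
Qed.

End geodesics.

(** * Transport along short curves *)

Section transport_theory.
Context {R : realType} {X : metricType R} (delta : R).
Hypothesis X_length : length_space X.
Variable W : transport X delta.
Local Notation tr := (tr W).
Implicit Types (f g : R -> X) (x y z : X).

Lemma tr_refl f a : continuous f -> tr f a a = 1%g.
Proof. by move=> cf; apply: (mulgI (tr f a a)); rewrite tr_cat // mulg1. Qed.

Lemma tr_inv f a b : continuous f -> tr f b a = ((tr f a b)^-1)%g.
Proof.
by move=> cf; apply: (mulgI (tr f a b)); rewrite tr_cat // tr_refl // mulgV.
Qed.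

Lemma tr_join f g a b c : continuous f -> continuous g -> f b = g b ->
  a <= b -> b <= c -> tr (join f g b) a c = (tr f a b * tr g b c)%g.
Proof.
move=> cf cg fg ab bc; have cj := join_continuous cf cg fg.
rewrite -(@tr_cat _ _ _ W _ a b c cj); congr (_ * _)%g.
  by apply: tr_eq => // t /andP[_ tb]; rewrite /join tb.
apply: tr_eq => // t /andP[bt _]; rewrite /join; case: ifPn => // tb.
by have -> : t = b by apply/eqP; rewrite eq_le tb bt.
Qed.

Definition geo x y : R -> X := sval (cid (length_space_geodesic x y X_length)).

Lemma geo0 x y : geo x y 0 = x.
Proof. by rewrite /geo; case: cid => c []. Qed.

Lemma geo1 x y : geo x y (mdist x y) = y.
Proof. by rewrite /geo; case: cid => c []. Qed.

Lemma geo_lipschitz x y : lipschitz_curve 1 (geo x y).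
Proof. by rewrite /geo; case: cid => c []. Qed.

Lemma geo_continuous x y : continuous (geo x y).
Proof. exact: lipschitz_curve_continuous (geo_lipschitz x y). Qed.

Lemma mdist_geol x y t : 0 <= t -> mdist x (geo x y t) <= t.
Proof.
move=> t0; have := lipschitz_curve_le (geo_lipschitz x y) t0.
by rewrite geo0 mul1r subr0.
Qed.

Lemma mdist_geor x y t : t <= mdist x y -> mdist (geo x y t) y <= mdist x y - t.
Proof.
move=> t0; have := lipschitz_curve_le (geo_lipschitz x y) t0.
by rewrite geo1 mul1r.
Qed.

Definition chord x y := tr (geo x y) 0 (mdist x y).

Lemma chord_refl x : chord x x = 1%g.
Proof. by rewrite /chord mdistxx tr_refl //; exact: geo_continuous. Qed.

(** The loop at [x] that follows a geodesic to [f a], then [f] from [a] to [b],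
    then a geodesic back; the curves are shifted to run one after another from
    time 0, at unit speed on the geodesics. *)
Definition cone x f (a b : R) : R -> X :=
  let d := mdist x (f a) in
  join (geo x (f a))
    (join (fun t => f (1 * t + (a - d)))
       (fun t => geo x (f b) (-1 * t + (d + (b - a) + mdist x (f b)))) (d + (b - a)))
    d.

Definition cone_length x f a b : R := mdist x (f a) + (b - a) + mdist x (f b).

Lemma comp_affine_continuous f (u v : R) : continuous f ->
  continuous (fun t => f (u * t + v)).
Proof.
move=> cf t; apply: (@continuous_comp _ _ _ (fun t : R => u * t + v) f).
  exact: affineR_continuous.
exact: cf.
Qed.

Section cone.
Variables (x : X) (f : R -> X) (a b : R).
Hypotheses (cf : continuous f) (ab : a <= b).
Let d := mdist x (f a).
Let e := d + (b - a).
Let l := cone_length x f a b.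

Let d0 : 0 <= d. Proof. exact: mdist_ge0. Qed.
Let de : d <= e. Proof. by rewrite /e lerDl subr_ge0. Qed.
Let el : e <= l. Proof. by rewrite /l /cone_length -/d -/e lerDl mdist_ge0. Qed.
Let eqd : geo x (f a) d = f (1 * d + (a - d)).
Proof. by rewrite geo1; congr f; ring. Qed.
Let eqe : f (1 * e + (a - d)) = geo x (f b) (-1 * e + (d + (b - a) + mdist x (f b))).
Proof.
rewrite -[in RHS]/e (_ : -1 * e + _ = mdist x (f b)); last by ring.
by rewrite geo1 /e; congr f; ring.
Qed.
Let eqd' : geo x (f a) d =
  join (fun t => f (1 * t + (a - d)))
       (fun t => geo x (f b) (-1 * t + (d + (b - a) + mdist x (f b)))) e d.
Proof. by rewrite /join de; exact: eqd. Qed.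

Lemma cone_continuous : continuous (cone x f a b).
Proof.
apply: join_continuous; [exact: geo_continuous| |exact: eqd'].
apply: join_continuous; [exact: comp_affine_continuous| |exact: eqe].
by apply: comp_affine_continuous; exact: geo_continuous.
Qed.

Lemma cone_lipschitz : lipschitz_curve 1 f -> lipschitz_curve 1 (cone x f a b).
Proof.
move=> hf; apply: join_lipschitz; [exact: geo_lipschitz| |exact: eqd'].
apply: join_lipschitz; [| |exact: eqe].
- by have := lipschitz_curve_affine 1 (a - d) hf; rewrite normr1 mulr1.
- have := lipschitz_curve_affine (-1) (d + (b - a) + mdist x (f b))
    (geo_lipschitz x (f b)).
  by rewrite normrN1 mulr1.
Qed.

Lemma tr_cone : tr (cone x f a b) 0 l =
  (chord x (f a) * tr f a b * (chord x (f b))^-1)%g.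
Proof.
have cg := geo_continuous; have ca := comp_affine_continuous.
rewrite /cone -/d -/e tr_join; [|exact: cg| |exact: eqd'|exact: d0|exact: le_trans de el].
  rewrite -mulgA; congr (_ * _)%g.
  rewrite tr_join; [|exact: ca|by apply: ca; exact: cg|exact: eqe|exact: de|exact: el].
  rewrite !tr_affine -tr_inv //; congr (tr _ _ _ * tr _ _ _)%g.
  - by ring.
  - by rewrite /e; ring.
  - by rewrite /l /cone_length /e /d; ring.
  - by rewrite /l /cone_length /e /d; ring.
by apply: join_continuous; [exact: ca|by apply: ca; exact: cg|exact: eqe].
Qed.

Lemma cone0 : cone x f a b 0 = x.
Proof. by rewrite /cone /join mdist_ge0 geo0. Qed.

Lemma cone1 : cone x f a b l = x.
Proof.
rewrite /cone /join -/d -/e; case: ifPn => ld.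
  have E : l = d by apply/eqP; rewrite eq_le ld (le_trans de el).
  have E' : e = d by apply/eqP; rewrite eq_le de -E el.
  have fab : a = b by move: E'; rewrite /e; lra.
  have : mdist x (f b) = 0 by move: E; rewrite /l /cone_length -/d -/e E'; lra.
  by move=> /mdist_positivity xb; rewrite E geo1 fab.
case: ifPn => le.
  have E : l = e by apply/eqP; rewrite eq_le le el.
  have fb : mdist x (f b) = 0 by move: E; rewrite /l /cone_length -/d -/e; lra.
  by rewrite E eqe fb -/e addr0 mulN1r addNr geo0.
by rewrite [X in geo _ _ X](_ : _ = 0) ?geo0 // /l /cone_length -/d /e; ring.
Qed.

(** Geodesics from the centre of a ball stay in the ball, so transport along
    a curve in a small ball depends only on the endpoints. *)
Lemma tr_in_ball : (forall t, a <= t <= b -> mdist x (f t) < delta) ->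
  tr f a b = ((chord x (f a))^-1 * chord x (f b))%g.
Proof.
move=> fball; suff : tr (cone x f a b) 0 l = 1%g.
  rewrite tr_cone => /divg1_eq <-; by rewrite mulKg.
have da := fball a; have db := fball b; rewrite lexx ab /= in da db.
apply: (@tr_ball _ _ _ W _ _ _ x).
- exact: cone_continuous.
- by rewrite (le_trans d0) // (le_trans de).
- by rewrite cone0 cone1.
move=> t /andP[t0 tl]; rewrite ballEmdist /= /cone /join -/d -/e.
case: ifPn => td.
  by apply: le_lt_trans (mdist_geol _ _ t0) _; apply: le_lt_trans td _; exact: da.
move: td; rewrite -ltNge => dt.
case: ifPn => te; first by apply: fball; move: te; rewrite /e; lra.
move: te; rewrite -ltNge => et.
move: tl; rewrite /l /cone_length -/d -/e => tl.
apply: le_lt_trans (mdist_geol _ _ _) _; first by lra.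
by have := db (lexx _); move: et; rewrite /e; lra.
Qed.

End cone.

(** Both geodesics between [x] and [y] lie in the ball around [x]. *)
Lemma chord_sym x y : mdist x y < delta -> chord y x = ((chord x y)^-1)%g.
Proof.
move=> xy; rewrite {1}/chord (@tr_in_ball x (geo y x)) ?mdist_ge0 //.
- by rewrite geo0 geo1 chord_refl mulg1.
- exact: geo_continuous.
- move=> t /andP[t0 t1]; rewrite metric_sym.
  by apply: le_lt_trans (mdist_geor t1) _; rewrite metric_sym; lra.
Qed.

(** Closed up with a geodesic, the curve becomes a loop of length less than
    [2 * delta], so every point of it is at distance less than [delta] from
    [f a] along one of the two arcs. *)
Lemma short_tr K f a b : lipschitz_curve K f -> a <= b ->
  K * (b - a) + mdist (f a) (f b) < 2 * delta -> tr f a b = chord (f a) (f b).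
Proof.
move=> hf ab short; rewrite (@tr_in_ball (f a)) //.
- by rewrite chord_refl invg1 mul1g.
- exact: lipschitz_curve_continuous hf.
move=> t /andP[at_ tb].
have h1 := lipschitz_curve_le hf at_; have h2 := lipschitz_curve_le hf tb.
have h3 := metric_triangle (f a) (f b) (f t); rewrite (metric_sym (f b)) in h3.
have : K * (b - a) = K * (t - a) + K * (b - t) by ring.
lra.
Qed.

End transport_theory.

(** * A shortest nontrivial loop *)

Lemma periodic_extension (R : realType) (X : metricType R) (K l : R)
    (f : R -> X) : 0 < l -> lipschitz_curve K f -> f 0 = f l ->
  exists g : R -> X, [/\ lipschitz_curve K g, forall t, g (t + l) = g t &
    forall t, 0 <= t <= l -> f t = g t].
Proof.
move=> l0 hf fl; pose m (t : R) : R := (Num.floor (t / l))%:~R.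
have K0 := lipschitz_curve_ge0 hf.
have mP t : m t * l <= t /\ t < (m t + 1) * l.
  have /andP[] := floor_itv (t / l); rewrite -/(m t) intrD.
  by rewrite ler_pdivlMr // ltr_pdivrMr.
exists (fun t => f (t - m t * l)); split.
- apply: lipschitz_curveP => s t st.
  have [s0 s1] := mP s; have [t0 t1] := mP t.
  have : Num.floor (s / l) <= Num.floor (t / l).
    by apply: le_floor; rewrite ler_pM2r ?invr_gt0.
  rewrite le_eqVlt => /predU1P[E|lt_st].
    have -> : m t = m s by rewrite /m E.
    apply: le_trans (hf _ _) _; apply: ler_wpM2l => //.
    rewrite opprD addrACA subrr addr0 ler_norml; lra.
  have mst : m s + 1 <= m t by rewrite /m -[1]/(1%:~R) -intrD ler_int lezD1.
  have := ler_wpM2r (ltW l0) mst => mstl.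
  (* Different periods are joined through the common value of [f] at 0 and [l]. *)
  apply: le_trans (metric_triangle _ (f l) _) _.
  have h1 := hf (s - m s * l) l; have h2 := hf 0 (t - m t * l); rewrite fl in h2.
  rewrite distrC ger0_norm in h1; last by lra.
  rewrite distrC subr0 ger0_norm in h2; last by lra.
  apply: le_trans (lerD h1 h2) _; rewrite -mulrDr; apply: ler_wpM2l => //; lra.
- move=> t; have -> : m (t + l) = m t + 1.
    by rewrite /m mulrDl divff ?gt_eqF // -[1 in LHS]/(1%:~R) floorDrz ?intr_int // intrKfloor intrD.
  by congr f; ring.
- move=> t /andP[t0]; rewrite le_eqVlt => /predU1P[->|tl].
    have -> : m l = 1 by rewrite /m divff ?gt_eqF // floor1.
    by rewrite mul1r subrr.
  have -> : m t = 0; last by rewrite mul0r subr0.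
  rewrite /m (@floor_def _ _ 0) // add0r ler_pdivlMr // ltr_pdivrMr //.
  by rewrite mul0r mul1r t0.
Qed.

Lemma uniform_on_unit_interval (R : realType) (X : metricType R) (f : R -> X)
    (eta : R) : continuous f -> 0 < eta ->
  exists n : nat, forall s t, 0 <= s <= 1 -> `|s - t| <= n.+1%:R^-1 ->
    mdist (f s) (f t) < eta.
Proof.
move=> cf eta0.
pose P (n : nat) (s : R) := forall t, `|s - t| <= n.+1%:R^-1 -> mdist (f s) (f t) < eta.
have /compact_near_coveringP/(_ _ \oo P) := @segment_compact R 0 1.
have loc (s : R) : `[0, 1]%classic s -> \forall s' \near s & n \near \oo, P n s'.
  move=> _.
  have : \forall u \near s, mdist (f s) (f u) < eta / 2.
    have := cf s => /cvg_ballP /(_ (eta / 2)); rewrite divr_gt0 // => /(_ isT).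
    by rewrite /prop_near1; apply: filterS => u; rewrite ballEmdist.
  move=> /nbhs_ballP [r /= r0 rP].
  have r20 : 0 < r / 2 by rewrite divr_gt0.
  near=> u n => t ut.
  have su : `|s - u| < r / 2 by near: u; exact: (nbhsx_ballx s _ r20).
  have nr : n.+1%:R^-1 < r / 2 by near: n; exact: (near_infty_natSinv_lt (PosNum r20)).
  have h1 : mdist (f s) (f u) < eta / 2.
    by apply: rP; rewrite /ball /=; lra.
  have h2 : mdist (f s) (f t) < eta / 2.
    apply: rP; rewrite /ball /=; apply: le_lt_trans (ler_distD u s t) _.
    by apply: lt_le_trans (ltrD su (le_lt_trans ut nr)) _; rewrite -splitr.
  have := metric_triangle (f u) (f s) (f t); rewrite (metric_sym (f u) (f s)); lra.
move=> /(_ _ loc) [n _ nP]; exists n => s t s01; apply: (nP n); first exact: leqnn.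
by rewrite /= in_itv.
Unshelve. all: by end_near. Qed.

Section minimal_loop.
Context {R : realType} {X : metricType R} (delta : R).
Hypotheses (delta0 : 0 < delta) (X_length : length_space X).
Variable W : transport X delta.
Local Notation tr := (tr W).
Local Notation chord := (chord X_length W).
Implicit Types (f g : R -> X) (x y z : X).

(** Subdivide [f] into arcs that stay in balls of radius [eta], and replace each
    arc by a geodesic. The triangles from [x] over consecutive division points
    share their sides, so the product of their transports telescopes. *)
Lemma loop_fills_by_triangles x (r eta : R) f : 0 < eta -> eta <= delta ->
  continuous f -> (forall t, mdist x (f t) < r) -> f 0 = f 1 ->
  (forall y z, mdist x y < r -> mdist x z < r -> mdist y z < eta ->
     (chord x y * chord y z)%g = chord x z) ->
  tr f 0 1 = 1%g.
Proof.
move=> eta0 eta_delta cf fball f01 triangles.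
have [n nP] := uniform_on_unit_interval cf eta0.
pose s (i : nat) : R := i%:R / n.+1%:R.
have n0 : 0 < n.+1%:R :> R by rewrite ltr0n.
have step i : s i.+1 = s i + n.+1%:R^-1 by rewrite /s -natr1 mulrDl mul1r.
have inv0 : 0 < n.+1%:R^-1 :> R by rewrite invr_gt0.
have tele i : (i <= n.+1)%N ->
    tr f 0 (s i) = ((chord x (f 0))^-1 * chord x (f (s i)))%g.
  elim: i => [_|i IH i_n].
    by rewrite /s mul0r tr_refl // mulVg.
  rewrite -(@tr_cat _ _ _ W f 0 (s i)) // IH; last exact: ltnW.
  have si : 0 <= s i <= 1.
    by rewrite /s divr_ge0 // ler_pdivrMr // mul1r ler_nat ltnW.
  have small t : s i <= t <= s i.+1 -> mdist (f (s i)) (f t) < eta.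
    rewrite step => /andP[t0 t1]; apply: nP => //.
    by rewrite distrC ger0_norm ?subr_ge0 // lerBlDl.
  have -> : tr f (s i) (s i.+1) = chord (f (s i)) (f (s i.+1)).
    rewrite (tr_in_ball X_length W (x := f (s i))) //.
    - by rewrite chord_refl invg1 mul1g.
    - by rewrite step lerDl ltW.
    - by move=> t /small /lt_le_trans; apply.
  rewrite -mulgA triangles //; apply: small.
  by rewrite lexx andbT step lerDl ltW.
have := tele n.+1 (leqnn _); rewrite /s divff ?gt_eqF // => ->.
by rewrite -f01 mulVg.
Qed.

Hypothesis new_loops : forall delta', delta < delta' ->
  exists x f, [/\ continuous f, forall t, mdist x (f t) < delta', f 0 = f 1 &
    tr f 0 1 <> 1%g].

Let pi0 : 0 < pi :> R. Proof. exact: pi_gt0. Qed.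

(** The nontrivial triangle found in a ball of radius [r] has perimeter less than
    [2 * r + eta], and [r] and [eta] are chosen so that this is at most
    [2 * delta']. *)
Lemma short_nontrivial_loop delta' : delta < delta' -> exists f : R -> X,
  [/\ lipschitz_curve (delta' / pi) f, f 0 = f (2 * pi) & tr f 0 (2 * pi) <> 1%g].
Proof.
move=> dd.
pose r := (delta + delta') / 2.
have dr : delta < r by rewrite /r; lra.
have [x [f [cf fr f01 ntf]]] := new_loops dr.
pose eta := Num.min delta (delta' - delta).
have [eta0 eta1 eta2] : [/\ 0 < eta, eta <= delta & eta <= delta' - delta].
  by rewrite /eta lt_min delta0 subr_gt0 dd !ge_min !lexx orbT.
have [y [z [xy xz yz nt]]] : exists y z, [/\ mdist x y < r, mdist x z < r,
    mdist y z < eta & (chord x y * chord y z)%g <> chord x z].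
  apply: contrapT => no; apply: ntf.
  apply: (@loop_fills_by_triangles x r eta) => // y z xy xz yz.
  by apply: contrapT => h; apply: no; exists y, z.
have yz0 := mdist_ge0 y z.
pose c := cone X_length x (geo X_length y z) 0 (mdist y z).
pose l := cone_length x (geo X_length y z) 0 (mdist y z).
have lE : l = mdist x y + mdist y z + mdist x z.
  by rewrite /l /cone_length geo0 geo1 subr0.
have cg := @geo_continuous _ _ X_length y z.
have hc : lipschitz_curve 1 c by apply: cone_lipschitz => //; exact: geo_lipschitz.
have l0 : 0 <= l by rewrite lE !addr_ge0 ?mdist_ge0.
have lpi : l / (2 * pi) * (2 * pi) + 0 = l.
  by rewrite addr0 divfK // mulf_neq0 // gt_eqF.
exists (fun t => c (l / (2 * pi) * t + 0)); split.
- have := lipschitz_curve_affine (l / (2 * pi)) 0 hc.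
  apply: lipschitz_curveW; rewrite mul1r ger0_norm; last first.
    by rewrite divr_ge0 // mulr_ge0 // ltW.
  rewrite invfM mulrA ler_pM2r ?invr_gt0 // lE; rewrite /r in xy xz; lra.
- by rewrite mulr0 addr0 lpi /c cone0 cone1.
- rewrite tr_affine mulr0 addr0 lpi tr_cone //.
  rewrite geo0 geo1 -[tr _ _ _]/(chord y z) => /divg1_eq; exact: nt.
Qed.

Hypothesis X_compact : compact [set: X].

(** Limits along an ultrafilter exist at all times simultaneously, so no
    subsequence has to be extracted. *)
Lemma ultra_limit (U : set_system nat) (u : nat -> X) : UltraFilter U ->
  exists y, forall e : R, 0 < e -> U [set n | mdist y (u n) < e].
Proof.
move=> UU; have PU := @ultra_proper _ _ UU.
have [y [_ yU]] := X_compact (fmap_proper_filter u PU) filterT.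
exists y => e e0; have [//|nU] := in_ultra_setVsetC [set n | mdist y (u n) < e] UU.
have nU' : (u x @[x --> U]) (~` ball y e).
  by rewrite /fmap /=; apply: filterS nU => n /=; rewrite ballEmdist.
by have [z []] := yU _ _ nU' (nbhsx_ballx y e e0).
Qed.

(** The square between [f] and [g] over each step of the subdivision lies in the
    ball of radius [delta] around [f (s i)], so it commutes. *)
Lemma tr_ladder f g (s : nat -> R) m : continuous f -> continuous g ->
  (forall i, s i <= s i.+1) ->
  (forall i t, s i <= t <= s i.+1 -> mdist (f (s i)) (f t) < delta / 2) ->
  (forall i t, s i <= t <= s i.+1 -> mdist (g (s i)) (g t) < delta / 2) ->
  (forall i, (i <= m)%N -> mdist (f (s i)) (g (s i)) < delta / 2) ->
  (tr f (s 0%N) (s m) * chord (f (s m)) (g (s m)) =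
   chord (f (s 0%N)) (g (s 0%N)) * tr g (s 0%N) (s m))%g.
Proof.
have half : delta / 2 < delta by rewrite ltr_pdivrMr // ltr_pMr // ltr1n.
move=> cf cg s_le fs gs fg; elim: m fg => [_|m IH fg].
  by rewrite !tr_refl // mul1g mulg1.
rewrite -(@tr_cat _ _ _ W f _ (s m)) // -(@tr_cat _ _ _ W g _ (s m)) //.
have fgm := fg m (leqnSn m); have fgm1 := fg m.+1 (leqnn _).
have fm1 : mdist (f (s m)) (f (s m.+1)) < delta / 2.
  by apply: fs; rewrite s_le lexx.
rewrite (tr_in_ball X_length W (x := f (s m)) (f := f) (a := s m)) //; last first.
  by move=> t /fs ft; exact: lt_trans ft half.
rewrite (tr_in_ball X_length W (x := f (s m)) (f := g) (a := s m)) //; last first.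
  move=> t /gs; have := metric_triangle (f (s m)) (g (s m)) (g t); lra.
rewrite chord_refl invg1 mul1g.
have -> : chord (f (s m.+1)) (g (s m.+1)) =
    ((chord (f (s m)) (f (s m.+1)))^-1 * chord (f (s m)) (g (s m.+1)))%g.
  rewrite {1}/chord (tr_in_ball X_length W (x := f (s m))) ?mdist_ge0 //.
  - by rewrite geo0 geo1.
  - exact: geo_continuous.
  - move=> t /andP[t0 t1]; have := mdist_geol X_length (f (s m.+1)) (g (s m.+1)) t0.
    have := metric_triangle (f (s m)) (f (s m.+1))
      (geo X_length (f (s m.+1)) (g (s m.+1)) t); lra.
rewrite [RHS]mulgA -IH; last by move=> i im; apply: fg; exact: leqW.
by rewrite -!mulgA !mulVKg.
Qed.

(** The Lipschitz bounds pass to the limit, and make closeness at finitely many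
    times enough to compare the limit with one of the nontrivial loops: their
    transports are conjugate. *)
Lemma minimal_nontrivial_loop : exists f : R -> X,
  [/\ lipschitz_curve (delta / pi) f, f 0 = f (2 * pi) & tr f 0 (2 * pi) <> 1%g].
Proof.
have inv0 n : 0 < n.+1%:R^-1 :> R by rewrite invr_gt0 ltr0n.
have [u uP] := choice (fun n => short_nontrivial_loop
  (delta' := delta + n.+1%:R^-1) (ltr_pwDr (inv0 n) (lexx _))).
have [U [UU ooU]] := @ultraFilterLemma nat \oo _.
have PU := @ultra_proper _ _ UU.
have [f fP] := choice (fun t => ultra_limit (fun n => u n t) UU).
have Uinv (e : R) : 0 < e -> U [set n | n.+1%:R^-1 < e].
  by move=> e0; apply: ooU; exact: (near_infty_natSinv_lt (PosNum e0)).
have f02 : f 0 = f (2 * pi).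
  apply: mdist_positivity; apply/eqP; rewrite eq_le mdist_ge0 andbT.
  apply/ler_addgt0Pl => e e0; rewrite addr0.
  have e20 : 0 < e / 2 by rewrite divr_gt0.
  have [n [/= n0 n1]] := filter_ex (filterI (fP 0 _ e20) (fP (2 * pi) _ e20)).
  have [_ un _] := uP n; rewrite -un in n1.
  have := metric_triangle (f 0) (u n 0) (f (2 * pi)).
  rewrite (metric_sym (u n 0)); lra.
have hf : lipschitz_curve (delta / pi) f.
  move=> s t; apply/ler_addgt0Pl => e e0.
  (* This makes the three error terms below add up to [e]. *)
pose e' := e / (2 + `|s - t| / pi).
  have st0 : 0 <= `|s - t| / pi by rewrite divr_ge0 // ltW.
  have e'0 : 0 < e' by rewrite divr_gt0 // ltr_wpDr.
  have [n [/= [ns nt] ne]] :=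
    filter_ex (filterI (filterI (fP s _ e'0) (fP t _ e'0)) (Uinv _ e'0)).
  have [hu _ _] := uP n; have h1 := hu s t.
  have h2 := metric_triangle (f s) (u n s) (f t).
  have h3 := metric_triangle (u n s) (u n t) (f t).
  rewrite (metric_sym (u n t)) in h3.
  have -> : e = 2 * e' + e' * (`|s - t| / pi).
    by rewrite (mulrC 2) -mulrDr /e' divfK // gt_eqF // ltr_wpDr.
  have h4 : (delta + n.+1%:R^-1) / pi * `|s - t| =
    delta / pi * `|s - t| + n.+1%:R^-1 * (`|s - t| / pi) by ring.
  have h5 : n.+1%:R^-1 * (`|s - t| / pi) <= e' * (`|s - t| / pi).
    by apply: ler_wpM2r => //; exact: ltW.
  rewrite h4 in h1; move: ns nt h1 h2 h3 h5 => /=.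
  set A := n.+1%:R^-1 * _; set B := delta / pi * _; set C := e' * (_ / _).
  lra.
exists f; split=> // trf1.
have cf := lipschitz_curve_continuous hf.
(* [K] bounds the speed of [f] and of all [u n]; with [m] steps of size [h],
   either curve moves by less than [delta / 2] during a step. *)
pose K := (delta + 1) / pi.
have d10 : 0 < delta + 1 by rewrite addr_gt0.
have K0 : 0 < K by rewrite divr_gt0.
pose m := Num.bound (4 * (delta + 1) / delta).
have mP : 4 * (delta + 1) / delta < m%:R.
  by rewrite archi_boundP // divr_ge0 ?mulr_ge0 // ltW.
have m0 : 0 < m%:R :> R.
  by apply: le_lt_trans mP; rewrite divr_ge0 ?mulr_ge0 // ltW.
pose h : R := 2 * pi / m%:R.
have h0 : 0 < h by rewrite divr_gt0 // mulr_gt0.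
have Kh : K * h < delta / 2.
  have -> : K * h = 2 * (delta + 1) / m%:R.
    rewrite /K /h; move: (pi : R) pi0 => P P0.
    by field; rewrite !gt_eqF.
  by rewrite ltr_pdivrMr //; move: mP; rewrite ltr_pdivrMr //; lra.
pose s (i : nat) : R := i%:R * h.
have sS i : s i.+1 = s i + h by rewrite /s -natr1 mulrDl mul1r.
have s_le i : s i <= s i.+1 by rewrite sS lerDl ltW.
have sm : s m = 2 * pi by rewrite /s /h mulrC divfK // gt_eqF.
have s0 : s 0%N = 0 by rewrite /s mul0r.
have d20 : 0 < delta / 2 by rewrite divr_gt0.
have close : U [set n | forall i : 'I_m.+1, mdist (f (s i)) (u n (s i)) < delta / 2].
  by apply: filter_forall => i; exact: fP.
have [n un] := filter_ex close.
have [hu u02 []] := uP n.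
have K_step (g : R -> X) (K' : R) : lipschitz_curve K' g -> K' <= K ->
    forall i t, s i <= t <= s i.+1 -> mdist (g (s i)) (g t) < delta / 2.
  move=> hg K'K i t; rewrite sS => /andP[t0 t1].
  apply: le_lt_trans Kh; apply: le_trans (lipschitz_curve_le hg t0) _.
  apply: ler_pM => //; [exact: lipschitz_curve_ge0 hg|by rewrite subr_ge0|].
  by rewrite lerBlDl.
have K1 : delta / pi <= K by rewrite ler_pM2r ?invr_gt0 // lerDl.
have K2 : (delta + n.+1%:R^-1) / pi <= K.
  rewrite ler_pM2r ?invr_gt0 // lerD2l invf_le1 ?ltr0n //.
  by rewrite ler1n.
have cu := lipschitz_curve_continuous hu.
have := @tr_ladder f (u n) s m cf cu s_le (K_step _ _ hf K1) (K_step _ _ hu K2).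
rewrite s0 sm trf1 mul1g -f02 -u02 => ladder.
apply: (mulgI (chord (f 0) (u n 0))); rewrite mulg1 -ladder // => i im.
exact: (un (Ordinal (im : (i < m.+1)%N))).
Qed.

End minimal_loop.

(** * The shortest nontrivial loop is a half geodesic *)

Section half_geodesic.
Context {R : realType} {X : metricType R} (delta : R).
Hypotheses (delta0 : 0 < delta) (X_length : length_space X).
Variables (W : transport X delta) (g : R -> X).
Local Notation tr := (tr W).
Hypotheses (g_lip : lipschitz_curve (delta / pi) g)
  (g_per : forall t, g (t + 2 * pi) = g t) (g_tr : tr g 0 (2 * pi) <> 1%g).

Let pi0 : 0 < pi :> R. Proof. exact: pi_gt0. Qed.
Let K0 : 0 <= delta / pi. Proof. exact: lipschitz_curve_ge0 g_lip. Qed.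
Let Kpi : delta / pi * pi = delta. Proof. by rewrite divfK // gt_eqF. Qed.
Let cg : continuous g. Proof. exact: lipschitz_curve_continuous g_lip. Qed.

(** A chord shorter than [delta] between antipodal points would cut the loop
    into two loops shorter than [2 * delta]. *)
Lemma antipodal_mdist t : mdist (g t) (g (t + pi)) = delta.
Proof.
have tpi : t <= t + pi by rewrite lerDl ltW.
have tpi2 : t + pi <= t + pi + pi by rewrite lerDl ltW.
have dist_le : mdist (g t) (g (t + pi)) <= delta.
  by apply: le_trans (lipschitz_curve_le g_lip tpi) _; rewrite addrAC subrr add0r Kpi.
apply/eqP; rewrite eq_le dist_le leNgt; apply/negP => short; apply: g_tr.
have E : t + pi + pi = t + 2 * pi by rewrite -addrA -mulr2n mulr_natl.
have gE : g (t + pi + pi) = g t by rewrite E g_per.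
have tr1 : tr g t (t + 2 * pi) = 1%g.
  rewrite -(@tr_cat _ _ _ W g _ (t + pi)) //.
  rewrite (short_tr X_length W g_lip tpi); last first.
    by rewrite addrAC subrr add0r Kpi; lra.
  rewrite -E (short_tr X_length W g_lip tpi2); last first.
    by rewrite [_ - (t + pi)]addrAC subrr add0r Kpi gE metric_sym; lra.
  by rewrite gE chord_sym ?mulVg // metric_sym.
have tr_shift : tr g (t + 2 * pi) (2 * pi) = tr g t 0.
  have := @tr_affine _ _ _ W g 1 (2 * pi) t 0.
  rewrite !mul1r add0r => <-; congr tr; apply/funext => u.
  by rewrite mul1r g_per.
rewrite -(@tr_cat _ _ _ W g _ t) // -(@tr_cat _ _ _ W g t (t + 2 * pi)) //.
by rewrite tr1 mul1g tr_shift tr_cat // tr_refl.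
Qed.

(** On the way from [g s] to its antipode, which is at the largest distance that
    the speed allows, no distance can be lost. *)
Lemma half_period_isometry s t : s <= t -> t - s <= pi ->
  mdist (g s) (g t) = delta / pi * (t - s).
Proof.
move=> st tspi; apply/eqP; rewrite eq_le lipschitz_curve_le //=.
have h1 := metric_triangle (g s) (g t) (g (s + pi)).
rewrite antipodal_mdist in h1.
have : mdist (g t) (g (s + pi)) <= delta / pi * (s + pi - t).
  by apply: lipschitz_curve_le => //; lra.
have -> : delta / pi * (s + pi - t) = delta / pi * pi - delta / pi * (t - s) by ring.
rewrite Kpi; lra.
Qed.

Lemma lipschitz_half_geodesic :
  half_geodesic g /\ circle_length g = (2 * delta)%:E.
Proof.
have len a b : a <= b -> curve_length g a b = (delta / pi * (b - a))%:E.
  by apply: (local_isometry_length pi0 g_lip); exact: half_period_isometry.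
have glen : circle_length g = (2 * delta)%:E.
  rewrite /circle_length len; last by rewrite mulr_ge0 // ltW.
  by rewrite subr0 mulrCA Kpi.
split=> //; split; last by move=> t; rewrite glen /= antipodal_mdist mulrAC divff ?mul1r.
split.
- by split.
- exists 0, (0 + pi) => E; have := antipodal_mdist 0.
  by rewrite E mdistxx => d0; move: delta0; rewrite -d0 ltxx.
- move=> t; exists (pi / 2); first by rewrite divr_gt0.
  move=> a b ta ab bt c [_ c0 c1]; rewrite len // -half_period_isometry //; last by lra.
  by rewrite -c0 -c1; exact: mdist_le_length.
- by rewrite glen.
- move=> a b ab; rewrite len // glen /=; congr (_ * _)%:E.
  by rewrite -mulf_div divff ?mul1r.
Qed.

End half_geodesic.

(** * The covering spectrum *)

Lemma length_space_path_connected (R : realType) (X : metricType R) :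
  length_space X -> path_connected R X.
Proof. by move=> h x y; have [c []] := h x y; exists c. Qed.

Section clamp.
Context {R : realType}.

Definition clamp (t : R) : R := if t <= 0 then 0 else if t <= 1 then t else 1.

Lemma clamp_continuous : continuous clamp.
Proof.
apply: continuous_if; first by rewrite ler01.
- by move=> t; exact: cvg_cst.
- apply: continuous_if => // t; [exact: cvg_id|exact: cvg_cst].
Qed.

Lemma clamp_in t : 0 <= clamp t <= 1.
Proof. by rewrite /clamp; case: ifPn => ?; [|case: ifPn => ?]; lra. Qed.

Lemma clampE t : 0 <= t <= 1 -> clamp t = t.
Proof. by rewrite /clamp => ?; case: ifPn => ?; [|case: ifPn => ?]; lra. Qed.

End clamp.

(** A path is continuous on the unit interval only; precomposing it with [clamp]
    gives a curve that is continuous everywhere and runs through the same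
    points. *)
Lemma CovSpec_transport (R : realType) (X : metricType R) (p : X) (delta : R) :
  length_space X -> CovSpec p delta -> exists W : transport X delta,
  forall delta', delta < delta' ->
  exists (x : X) (f : R -> X), [/\ continuous f, forall t, mdist x (f t) < delta',
    f 0 = f 1 & tr W f 0 1 <> 1%g].
Proof.
move=> X_length Hdelta; have X_conn := length_space_path_connected X_length.
have [W trW] := pi1_delta_transport p delta X_conn; exists W => delta' dd.
have [_ [[al [be [x [alP beP be_ball ->]]]] nH]] := CovSpec_new_loop Hdelta dd.
have [cbe _ be1] := beP; have [cal _ _] := alP.
pose f := be \o (@clamp R).
have fE t : 0 <= t <= 1 -> f t = be t by move=> t01; rewrite /f /= clampE.
have f0 : f 0 = be 0 by rewrite fE ?lexx ?ler01.
have f1 : f 1 = be 0 by rewrite fE ?lexx ?ler01.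
have cf : continuous f.
  apply/continuous_subspace_setT; apply: interval_comp => //; first exact: clamp_continuous.
  by move=> t _; exact: clamp_in.
exists x, f; split=> //.
- by move=> t; have := be_ball _ (clamp_in t); rewrite ballEmdist.
- by rewrite f0 f1.
move=> tr1; apply: nH.
have := trW al f cf; rewrite f0 f1 => /(_ alP erefl tr1) Hf.
have fP : is_path (be 0) (be 0) f.
  by apply: is_pathP beP _ => t t01; rewrite fE.
apply: (pi1_homotopic (pi1_delta_normal p delta) Hf).
apply: (htp_eq (is_path_cat (is_path_cat alP fP) (is_path_rev alP))) => t /andP[t0 t1].
rewrite /path_cat; case: ifPn => // t2; case: ifPn => // t4.
by rewrite fE //; lra.
Qed.

Unset Implicit Arguments.

Theorem theorem4p1 (R : realType) (X : metricType R) (p : X)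
    (X_compact : compact [set: X])
    (X_length : length_space X)
    (X_cover : exists C : space_over X,
        @universal_cover R X C /\ simply_connected R (total_space C)) :
  [set 2 * delta | delta in CovSpec p] `<=` L_half X.
Proof.
move=> _ [delta Hdelta <-]; have [delta0 _] := Hdelta.
have [W new_loops] := CovSpec_transport X_length Hdelta.
have [f [hf f02 trf]] :=
  minimal_nontrivial_loop delta0 X_length new_loops X_compact.
have pi20 : 0 < 2 * pi :> R by rewrite mulr_gt0 // pi_gt0.
have [g [hg g_per fg]] := periodic_extension pi20 hf f02.
exists g; apply: (@lipschitz_half_geodesic _ _ _ delta0 X_length W) => //.
rewrite -(@tr_eq _ _ _ W f g) //; last exact: ltW.
exact: lipschitz_curve_continuous hf.
Qed.
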